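(* Let $\Gamma=(m_{i,j})_{i,j\in I}$ be a Coxeter matrix and let $\tilde I$ be an admissible partition of $\Gamma$, of type $\tilde\Gamma=(|r_\alpha r_\beta|)_{\alpha,\beta\in\tilde I}$. Then: (1) the map $\mathbf S_{\tilde\Gamma}\to B^+_\Gamma$, $\mathbf s_\alpha\mapsto \mathbf r_\alpha$ ($\alpha\in\tilde I$), extends to a monoid morphism $\varphi: B^+_{\tilde\Gamma}\to B^+_\Gamma$; (2) this morphism respects lcm's, hence is injective. In particular, if $\tilde{\mathbf S}=\{\mathbf r_\alpha\mid\alpha\in\tilde I\}$ and $\tilde B^+$ denotes the submonoid of $B^+_\Gamma$ generated by $\tilde{\mathbf S}$, then the pair $(\tilde B^+,\tilde{\mathbf S})$ is isomorphic to the positive Artin-Tits system $(B^+_{\tilde\Gamma},\mathbf S_{\tilde\Gamma})$ of type $\tilde\Gamma$.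
   Context: A Coxeter matrix over an arbitrary (possibly infinite) set $I$ is a family $\Gamma=(m_{i,j})_{i,j\in I}$ with $m_{i,j}=m_{j,i}\in\mathbb N_{\geq 1}\cup\{\infty\}$ and $m_{i,j}=1\iff i=j$. For $n\in\mathbb N$, $\prod_n(x,y)$ is the alternating product $xyxy\cdots$ with $n$ factors starting with $x$. $W_\Gamma$ is the Coxeter group generated by $s_i$ ($i\in I$) with relations $s_i^2=1$ and $\prod_{m_{i,j}}(s_i,s_j)=\prod_{m_{i,j}}(s_j,s_i)$ if $m_{i,j}\ne\infty$. $B^+_\Gamma$ is the monoid presented by generators $\mathbf S_\Gamma=\{\mathbf s_i\mid i\in I\}$ and relations $\prod_{m_{i,j}}(\mathbf s_i,\mathbf s_j)=\prod_{m_{i,j}}(\mathbf s_j,\mathbf s_i)$ for $m_{i,j}\neq\infty$; $(B^+_\Gamma,\mathbf S_\Gamma)$ is the positive Artin-Tits system of type $\Gamma$. Two pairs (monoid, generating set) are isomorphic if there is a monoid isomorphism carrying one generating set onto the other. $\ell$ denotes word length on $W_\Gamma$ with respect to $\{s_i\}$. For $w\in W_\Gamma$, $\mathbf w\in B^+_\Gamma$ is the element represented by any reduced word of $w$ (well defined by Tits' theorem). For $J\subseteq I$, $\Gamma_J=(m_{i,j})_{i,j\in J}$ and $W_J=\langle s_j\mid j\in J\rangle$. $J$ (or $\Gamma_J$) is spherical if $W_J$ is finite; then $r_J$ is the unique element of maximal length in $W_J$ and $\mathbf r_J\in B^+_\Gamma$ is the corresponding element. A partition $\tilde I$ of $I$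 (into non-empty parts) is spherical if every $\alpha\in\tilde I$ is spherical. Then $\tilde W=\langle r_\alpha\mid\alpha\in\tilde I\rangle\subseteq W_\Gamma$, and the type of $\tilde I$ is the Coxeter matrix $\tilde\Gamma=(|r_\alpha r_\beta|)_{\alpha,\beta\in\tilde I}$ of orders of the products $r_\alpha r_\beta$ in $W_\Gamma$. For $w\in W_\Gamma$, put $I^{\pm}(w)=\{i\in I\mid \ell(ws_i)=\ell(w)\pm1\}$. The partition $\tilde I$ is admissible if it is spherical and for all $(w,\alpha)\in\tilde W\times\tilde I$ either $\alpha\subseteq I^+(w)$ or $\alpha\subseteq I^-(w)$. In a monoid, $y\preccurlyeq x$ means $x=yz$ for some $z$ (left divisibility); a right lcm of two elements is a common right multiple that left-divides every common right multiple; left lcm's are defined symmetrically. In $B^+_\Gamma$ (cancellative, no non-trivial units) lcm's are unique when they exist; write $x\vee_R y$, $x\vee_L y$. A morphism $\varphi:B^+_{\tilde\Gamma}\to B^+_\Gamma$ respects right lcm's if $\varphi(\mathbf s_\alpha)\ne1$ for all $\alpha$, and for all $\alpha,\beta$, $\mathbf s_\alpha\vee_R\mathbf s_\beta$ exists in $B^+_{\tilde\Gamma}$ if and only if $\varphi(\mathbf s_\alpha)\vee_R\varphi(\mathbf s_\beta)$ exists in $B^+_\Gamma$, in which case $\varphi(\mathbf s_\alpha)\vee_R\varphi(\mathbf s_\beta)=\varphi(\mathbf s_\alpha\vee_R\mathbf s_\beta)$. Respecting left lcm's is defined symmetrically; $\varphi$ respects lcm's if it respects both right and left lcm's. *)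

(* Defs.v *)
From HB Require Import structures.
From mathcomp Require Import all_boot.
From mathcomp Require Import boolp classical_sets cardinality.

Set Implicit Arguments.
Unset Strict Implicit.
Unset Printing Implicit Defensive.

Local Open Scope classical_set_scope.
Local Open Scope group_scope.
Local Open Scope quotient_scope.

(* Monoids given by generators and relations: words modulo the congruence
   generated by R. *)
Inductive cong (X : Type) (R : seq X -> seq X -> Prop) : seq X -> seq X -> Prop :=
| cong_rel a b u v : R u v -> cong R (a ++ u ++ b) (a ++ v ++ b)
| cong_refl u : cong R u u
| cong_sym u v : cong R u v -> cong R v u
| cong_trans u v w : cong R u v -> cong R v w -> cong R u w.

Section PresentedMonoid.
Variables (X : Type) (R : seq X -> seq X -> Prop).

Lemma cong_ctx a b u v : cong R u v -> cong R (a ++ u ++ b) (a ++ v ++ b).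
Proof.
elim=> {u v} [c d u v Ruv|u|u v _ IH|u v w _ IH1 _ IH2].
- by have := cong_rel (a ++ c) (d ++ b) Ruv; rewrite -!catA.
- exact: cong_refl.
- exact: cong_sym.
- exact: cong_trans IH1 IH2.
Qed.

Lemma cong_cat u u' v v' :
  cong R u u' -> cong R v v' -> cong R (u ++ v) (u' ++ v').
Proof.
move=> uu' vv'; apply: (@cong_trans _ _ _ (u' ++ v)).
  exact: (cong_ctx [::] v uu').
by have := cong_ctx u' [::] vv'; rewrite !cats0.
Qed.

(* X has no choice structure of its own, hence {classic _}. *)
Definition congb (u v : {classic seq X}) : bool := `[< cong R u v >].

Lemma congb_refl : reflexive congb.
Proof. by move=> u; apply/asboolP/cong_refl. Qed.

Lemma congb_sym : symmetric congb.
Proof. by move=> u v; apply/idP/idP => /asboolP /cong_sym /asboolP. Qed.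

Lemma congb_trans : transitive congb.
Proof.
by move=> v u w /asboolP uv /asboolP vw; apply/asboolP/(cong_trans uv vw).
Qed.

Canonical congb_equiv := EquivRel congb congb_refl congb_sym congb_trans.

Definition pres_monoid := {eq_quot congb}.

HB.instance Definition _ := Choice.on pres_monoid.

Definition pres_class (u : seq X) : pres_monoid := \pi_{eq_quot congb} u.

Lemma pres_classP u v : pres_class u = pres_class v <-> cong R u v.
Proof.
split=> [/eqquotP/asboolP//|uv]; exact/eqquotP/asboolP.
Qed.

Definition pres_repr (x : pres_monoid) : seq X := repr x.

Lemma pres_reprK x : pres_class (pres_repr x) = x.
Proof. exact: reprK. Qed.

Definition pres_mul (x y : pres_monoid) := pres_class (pres_repr x ++ pres_repr y).

Lemma pres_class_cat u v :
  pres_mul (pres_class u) (pres_class v) = pres_class (u ++ v).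
Proof.
by apply/pres_classP/cong_cat; apply/pres_classP; rewrite pres_reprK.
Qed.

Lemma pres_mulA : associative pres_mul.
Proof.
move=> x y z; rewrite -(pres_reprK x) -(pres_reprK y) -(pres_reprK z).
by rewrite !pres_class_cat catA.
Qed.

Lemma pres_mul1 : left_id (pres_class [::]) pres_mul.
Proof. by move=> x; rewrite -(pres_reprK x) pres_class_cat. Qed.

Lemma pres_1mul : right_id (pres_class [::]) pres_mul.
Proof. by move=> x; rewrite -(pres_reprK x) pres_class_cat cats0. Qed.

HB.instance Definition _ :=
  isMonoid.Build pres_monoid pres_mulA pres_mul1 pres_1mul.

Lemma pres_classM u v : pres_class (u ++ v) = pres_class u * pres_class v.
Proof. by rewrite -pres_class_cat. Qed.

End PresentedMonoid.

(* Groups given by generators and relations between positive words, as the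
   monoid generated by the letters x = (x, false) and x^-1 = (x, true). *)
Definition pos_word (X : Type) (u : seq X) : seq (X * bool) :=
  [seq (x, false) | x <- u].

Inductive group_rel (X : Type) (R : seq X -> seq X -> Prop) :
  seq (X * bool) -> seq (X * bool) -> Prop :=
| group_rel_inv x b : group_rel R [:: (x, b); (x, ~~ b)] [::]
| group_rel_pos u v : R u v -> group_rel R (pos_word u) (pos_word v).

Section PresentedGroup.
Variables (X : Type) (R : seq X -> seq X -> Prop).

Definition pres_group := pres_monoid (group_rel R).

HB.instance Definition _ := Monoid.on pres_group.

Definition inv_word (u : seq (X * bool)) : seq (X * bool) :=
  rev [seq (p.1, ~~ p.2) | p <- u].

Lemma inv_wordK : involutive inv_word.
Proof.
move=> u; rewrite /inv_word map_rev revK -map_comp -[RHS]map_id.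
by apply: eq_map => -[x b] /=; rewrite negbK.
Qed.

Lemma cong_inv_word u : cong (group_rel R) (u ++ inv_word u) [::].
Proof.
elim: u => [|[x b] u IH]; first exact: cong_refl.
rewrite /inv_word /= rev_cons -cats1 -/(inv_word u).
apply: cong_trans (cong_rel [::] [::] (group_rel_inv R x b)).
by have := cong_ctx [:: (x, b)] [:: (x, ~~ b)] IH; rewrite /= -catA.
Qed.

Definition pres_inv (x : pres_group) : pres_group :=
  pres_class (group_rel R) (inv_word (pres_repr x)).

Lemma pres_mulgV : right_inverse 1 pres_inv (@mul pres_group).
Proof.
move=> x; rewrite -{1}(pres_reprK x) -pres_classM.
exact/pres_classP/cong_inv_word.
Qed.

Lemma pres_mulVg : left_inverse 1 pres_inv (@mul pres_group).
Proof.
move=> x; rewrite -{2}(pres_reprK x) -pres_classM.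
apply/pres_classP; rewrite -{2}(inv_wordK (pres_repr x)).
exact: cong_inv_word.
Qed.

HB.instance Definition _ := hasInv.Build pres_group pres_inv.
HB.instance Definition _ :=
  Monoid_isGroup.Build pres_group pres_mulVg pres_mulgV.

Definition pres_gen (x : X) : pres_group :=
  pres_class (group_rel R) [:: (x, false)].

End PresentedGroup.

Definition gen_subgroup (G : groupType) (S : set G) : set G :=
  smallest (fun H : set G => group_closed (mem H)) S.

Definition gen_submonoid (M : monoidType) (S : set M) : set M :=
  smallest (fun H : set M => monoid_closed (mem H)) S.

Section SubmonoidType.
Variables (M : monoidType) (S : set M).

Lemma gen_submonoid_closed : monoid_closed (mem (gen_submonoid S)).
Proof.
split; first by rewrite inE => A [[/set_mem A1 _] _].
move=> x y /set_mem Sx /set_mem Sy; rewrite inE => A SA.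
by case: (SA) => -[_ AM] _; apply/set_mem/AM; apply/mem_set; [apply: Sx|apply: Sy].
Qed.

Definition submonoid := {x : M | x \in gen_submonoid S}.

HB.instance Definition _ := SubChoice.on submonoid.
HB.instance Definition _ := SubChoice_isSubMonoid.Build M
  (fun x => x \in gen_submonoid S) submonoid gen_submonoid_closed.

End SubmonoidType.

(* Isomorphism of pairs (monoid, generating set). *)
Definition pair_iso (M N : monoidType) (S : set M) (T : set N) : Prop :=
  exists f : M -> N, [/\ monoid_morphism f, bijective f & f @` S = T].

(* None stands for infinite order. *)
Definition elt_order (G : groupType) (x : G) : option nat :=
  if pselect (exists n, (0 < n)%N && (x ^+ n == 1)) is left h
  then Some (ex_minn h) else None.

Section Lcm.
Variable M : monoidType.
Implicit Types x y z t : M.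

Definition left_dvd y x := exists z, x = y * z.
Definition right_dvd y x := exists z, x = z * y.

Definition is_right_lcm x y z :=
  [/\ left_dvd x z, left_dvd y z &
      forall t, left_dvd x t -> left_dvd y t -> left_dvd z t].

Definition is_left_lcm x y z :=
  [/\ right_dvd x z, right_dvd y z &
      forall t, right_dvd x t -> right_dvd y t -> right_dvd z t].

End Lcm.

Section Coxeter.
Variables (I : Type) (m : I -> I -> option nat).

(* m i j = None stands for an infinite entry. *)
Definition coxeter_matrix : Prop :=
  [/\ forall i j, m i j = m j i,
      forall i j, m i j <> Some 0%N &
      forall i j, m i j = Some 1%N <-> i = j].

Fixpoint alt (n : nat) (i j : I) : seq I :=
  if n is n'.+1 then i :: alt n' j i else [::].

Inductive braid_rel : seq I -> seq I -> Prop :=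
| braid_rel_intro i j n : m i j = Some n -> braid_rel (alt n i j) (alt n j i).

Inductive coxeter_rel : seq I -> seq I -> Prop :=
| coxeter_rel_square i : coxeter_rel [:: i; i] [::]
| coxeter_rel_braid u v : braid_rel u v -> coxeter_rel u v.

Definition artin_monoid := pres_monoid braid_rel.
HB.instance Definition _ := Monoid.on artin_monoid.

Definition artin_gen (i : I) : artin_monoid := pres_class braid_rel [:: i].

Definition coxeter_group := pres_group coxeter_rel.
HB.instance Definition _ := Group.on coxeter_group.

Definition coxeter_gen (i : I) : coxeter_group := pres_gen coxeter_rel i.

Definition coxeter_word (u : seq I) : coxeter_group :=
  \prod_(i <- u) coxeter_gen i.

Lemma coxeter_gen_sqr i : coxeter_gen i * coxeter_gen i = 1.
Proof.
rewrite /coxeter_gen /pres_gen -pres_classM.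
apply/pres_classP.
exact: (cong_rel [::] [::] (group_rel_pos (coxeter_rel_square i))).
Qed.

Lemma coxeter_word_surj (w : coxeter_group) :
  exists n, `[< exists2 u, coxeter_word u = w & size u = n >].
Proof.
suff [u uw] : exists u, coxeter_word u = w.
  by exists (size u); apply/asboolP; exists u.
rewrite -(pres_reprK w); elim: (pres_repr w) => [|[i b] u [v IH]].
  by exists [::]; rewrite /coxeter_word big_nil.
exists (i :: v); rewrite /coxeter_word big_cons -/(coxeter_word v) IH.
rewrite -cat1s pres_classM; congr (_ * _); case: b => //.
apply: (@mulIg coxeter_group (coxeter_gen i)); rewrite coxeter_gen_sqr.
rewrite /coxeter_gen /pres_gen -pres_classM; apply/esym/pres_classP.
exact: (cong_rel [::] [::] (group_rel_inv coxeter_rel i true)).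
Qed.

Definition coxeter_length (w : coxeter_group) : nat :=
  ex_minn (coxeter_word_surj w).

Definition reduced_word (w : coxeter_group) (u : seq I) : Prop :=
  coxeter_word u = w /\ size u = coxeter_length w.

(* The positive lift of w, read off from one chosen reduced word of w; by Tits'
   theorem the result does not depend on that word when m is a Coxeter matrix. *)
Definition artin_lift (w : coxeter_group) : artin_monoid :=
  pres_class braid_rel (xget ([::] : {classic seq I}) (reduced_word w)).

Definition parabolic (J : set I) : set coxeter_group :=
  gen_subgroup (coxeter_gen @` J).

Definition spherical (J : set I) : Prop := finite_set (parabolic J).

(* r_J; the default value 1 is never used when J is spherical. *)
Definition longest (J : set I) : coxeter_group :=
  xget 1 [set w | parabolic J w /\
    forall v, parabolic J v -> v <> w ->
      (coxeter_length v < coxeter_length w)%N].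

Definition ascents (w : coxeter_group) : set I :=
  [set i | coxeter_length (w * coxeter_gen i) = (coxeter_length w).+1].

(* Stated without truncated subtraction. *)
Definition descents (w : coxeter_group) : set I :=
  [set i | (coxeter_length (w * coxeter_gen i)).+1 = coxeter_length w].

(* A partition of I is the set P of its blocks; the indices of the matrix
   partition_type P are the elements of P. *)
Definition tilde_group (P : set (set I)) : set coxeter_group :=
  gen_subgroup (longest @` P).

Definition spherical_partition (P : set (set I)) : Prop :=
  partition P id setT /\ forall a, P a -> spherical a.

Definition admissible_partition (P : set (set I)) : Prop :=
  spherical_partition P /\
  forall w a, tilde_group P w -> P a -> a `<=` ascents w \/ a `<=` descents w.

Definition partition_type (P : set (set I)) (a b : P) : option nat :=
  elt_order (longest (val a) * longest (val b)).

End Coxeter.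

(* x \/_R y "exists" means that some z satisfies is_right_lcm x y z; lcm's in
   artin_monoid m are unique because it is cancellative without non-trivial
   units, so quantifying over all lcm's is quantifying over the lcm. *)
Section RespectsLcm.
Variables (I' I : Type) (m' : I' -> I' -> option nat) (m : I -> I -> option nat).
Variable f : artin_monoid m' -> artin_monoid m.

Local Notation s := (artin_gen m').

Definition respects_right_lcms : Prop :=
  (forall a, f (s a) <> 1) /\
  forall a b,
    ((exists z, is_right_lcm (s a) (s b) z) <->
     (exists z, is_right_lcm (f (s a)) (f (s b)) z)) /\
    forall z z', is_right_lcm (s a) (s b) z ->
      is_right_lcm (f (s a)) (f (s b)) z' -> z' = f z.

Definition respects_left_lcms : Prop :=
  (forall a, f (s a) <> 1) /\
  forall a b,
    ((exists z, is_left_lcm (s a) (s b) z) <->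
     (exists z, is_left_lcm (f (s a)) (f (s b)) z)) /\
    forall z z', is_left_lcm (s a) (s b) z ->
      is_left_lcm (f (s a)) (f (s b)) z' -> z' = f z.

Definition respects_lcms : Prop := respects_right_lcms /\ respects_left_lcms.

End RespectsLcm.

(* Main.v *)
(* In the Coxeter group W, left descents are detected by the parity with which
   a simple reflection occurs among the inversions of a word, which gives the
   exchange condition; the orders of the products s_i s_j are read off a
   representation with coefficients -(z + 1/z), z a primitive 2m-th root of 1.
   Left weak order then has meets. Two blocks a, b of an admissible partition
   behave like two generators: the lengths of the alternating products of r_a
   and r_b add up until one of them has both a and b as left descents, and this
   happens exactly at the order of r_a r_b; the product is then the top of the
   parabolic subgroup of a and b.

   In B^+, s_i x = s_j y implies that x and y are the complements of s_i and s_j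
   times a common element (for i = j: left cancellation). The induction on
   length rests on the fact that every element has a greatest simple left
   divisor. Hence a common right multiple of the lifts of r_a and r_b is a
   multiple of the lift of their alternating product. This property of the
   morphism phi makes divisibility reflect along phi by induction on length,
   which yields injectivity and right lcms; left lcms follow by reversal. *)
Require Import Defs.
From mathcomp Require Import all_boot.
From mathcomp Require Import boolp classical_sets cardinality.
From mathcomp Require ssralg poly ssrnum algC cyclotomic ring.

Set Implicit Arguments.
Unset Strict Implicit.
Unset Printing Implicit Defensive.

Local Open Scope group_scope.

(** * Coxeter groups *)

Section AlternatingWords.
Variable I : Type.
Implicit Types i j : I.

Lemma size_alt n i j : size (alt n i j) = n.
Proof. by elim: n i j => //= n IH i j; rewrite IH. Qed.

Lemma alt_cat p q i j :
  alt (p + q) i j = alt p i j ++ (if odd p then alt q j i else alt q i j).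
Proof. by elim: p i j => //= p IH i j; rewrite IH; case: odd. Qed.

Lemma altS_rcons n i j : alt n.+1 i j = rcons (alt n i j) (if odd n then j else i).
Proof. by rewrite -addn1 alt_cat -cats1; case: odd. Qed.

Lemma rev_alt n i j : rev (alt n i j) = if odd n then alt n i j else alt n j i.
Proof.
elim: n i j => // n IH i j; rewrite /= rev_cons IH.
have := altS_rcons n i j; have := altS_rcons n j i.
by case: odd => /= ji ij; rewrite ?ji ?ij.
Qed.

Lemma alt_double n i j : alt n.*2 i j = alt n i j ++ rev (alt n j i).
Proof. by rewrite -addnn alt_cat rev_alt; case: odd. Qed.

Lemma alt_doubleS n i j : alt n.+1.*2 i j = i :: j :: alt n.*2 i j.
Proof. by []. Qed.

End AlternatingWords.

(** * Words in the generators, and actions of the Coxeter group *)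

Section CoxeterWords.
Variables (I : Type) (m : I -> I -> option nat).
Local Notation s := (coxeter_gen m).
Local Notation cw := (coxeter_word m).

Lemma coxeter_word_nil : cw [::] = 1.
Proof. by rewrite /coxeter_word big_nil. Qed.

Lemma coxeter_word_cons i u : cw (i :: u) = s i * cw u.
Proof. by rewrite /coxeter_word big_cons. Qed.

Lemma coxeter_word_cat u v : cw (u ++ v) = cw u * cw v.
Proof. by rewrite /coxeter_word big_cat. Qed.

Lemma coxeter_word1 i : cw [:: i] = s i.
Proof. by rewrite coxeter_word_cons coxeter_word_nil mulg1. Qed.

Lemma coxeter_genK i : cancel (mul (s i)) (mul (s i)).
Proof. by move=> x; rewrite mulgA coxeter_gen_sqr mul1g. Qed.

Lemma coxeter_genV i : (s i)^-1 = s i.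
Proof. by apply: mulg1_eq; apply: coxeter_gen_sqr. Qed.

Lemma coxeter_word_rev u : cw (rev u) = (cw u)^-1.
Proof.
elim: u => [|i u IH]; first by rewrite coxeter_word_nil invg1.
by rewrite rev_cons -cats1 coxeter_word_cat coxeter_word1 IH coxeter_word_cons
  invgM coxeter_genV.
Qed.

Lemma coxeter_word_class u : cw u = pres_class (group_rel (coxeter_rel m)) (pos_word u).
Proof.
elim: u => [|i u IH]; first by rewrite coxeter_word_nil.
rewrite coxeter_word_cons IH /coxeter_gen /pres_gen.
by rewrite -[pos_word (i :: u)]/([:: (i, false)] ++ _) pres_classM.
Qed.

Lemma coxeter_word_exists w : exists u, cw u = w.
Proof. by have [n /asboolP[u]] := coxeter_word_surj w; exists u. Qed.

Lemma coxeter_word_alt_double n i j : cw (alt n.*2 i j) = (s i * s j) ^+ n.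
Proof.
elim: n => [|n IH]; first by rewrite coxeter_word_nil.
by rewrite alt_doubleS !coxeter_word_cons IH expgS mulgA.
Qed.

Lemma coxeter_word_alt_eq n i j :
  cw (alt n i j) = cw (alt n j i) <-> (s i * s j) ^+ n = 1.
Proof.
rewrite -coxeter_word_alt_double alt_double coxeter_word_cat coxeter_word_rev.
by split=> [->|/divg1_eq //]; rewrite mulgV.
Qed.

Lemma coxeter_braid i j n : m i j = Some n -> (s i * s j) ^+ n = 1.
Proof.
move=> mij; apply/coxeter_word_alt_eq; rewrite !coxeter_word_class.
apply/pres_classP; have := cong_rel [::] [::] (group_rel_pos
  (coxeter_rel_braid (braid_rel_intro mij))).
by rewrite /= !cats0.
Qed.

(** A tool for separating group elements: an action has to be checked only on squares and on the
    words [alt n.*2 i j]. It serves both the reflection representation and the inversion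
    parities. *)
Lemma coxeter_act (X : Type) (A : I -> X -> X) :
  (forall i, involutive (A i)) ->
  (forall i j n, m i j = Some n -> forall x, foldr A x (alt n.*2 i j) = x) ->
  forall u v, cw u = cw v -> forall x, foldr A x u = foldr A x v.
Proof.
move=> AK Abraid.
pose B (u : seq (I * bool)) x := foldr (fun p : I * bool => A p.1) x u.
have Bpos u x : B (pos_word u) x = foldr A x u by elim: u => //= i u ->.
have Brev u x : foldr A (foldr A x u) (rev u) = x.
  by elim: u => //= i u IH; rewrite rev_cons foldr_rcons AK.
have Bcat u v x : B (u ++ v) x = B u (B v x) by rewrite /B foldr_cat.
have Bcong u v : cong (group_rel (coxeter_rel m)) u v -> forall x, B u x = B v x.
  elim=> {u v} [a b u v uv|//|u v _ IH|u v w _ IH1 _ IH2] x; last first.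
  - by rewrite IH1.
  - by rewrite IH.
  rewrite !Bcat; congr (B a _); move: (B b x) => {a b}x.
  case: uv => [i b|{}u {}v]; first exact: AK.
  case=> [i|{}u {}v [i j n mij]]; rewrite !Bpos; first exact: AK.
  rewrite -[RHS](Abraid i j n mij) alt_double foldr_cat; congr foldr.
  by rewrite Brev.
move=> u v; rewrite !coxeter_word_class => /pres_classP/Bcong uv x.
by rewrite -!Bpos.
Qed.

End CoxeterWords.

(** * Orders of products of two generators, from a reflection representation *)

Module Geometric.
Import ssralg poly GRing.Theory ssrnum Num.Theory algC cyclotomic ring.
Local Open Scope ring_scope.

(* The value 2 for an infinite entry only has to be nonzero and not a root of
   unity; the value at [Some 0] is never used. *)
Definition zeta (n : option nat) : algC :=
  if n is Some k.+1 then sval (C_prim_root_exists (ltn0Sn k.*2.+1)) else 2.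

Lemma zeta_prim k : (k.+1.*2).-primitive_root (zeta (Some k.+1)).
Proof. by rewrite /zeta; case: C_prim_root_exists. Qed.

Lemma zeta_neq0 n : zeta n != 0.
Proof.
case: n => [[|k]|]; try by rewrite pnatr_eq0.
apply/eqP => z0; have /eqP := prim_expr_order (zeta_prim k).
by rewrite z0 expr0n eq_sym oner_eq0.
Qed.

(** For [n = Some k] with [k > 0], a Galois conjugate of [2 cos(pi / k)]; the choice of the
    primitive root is immaterial. On the diagonal it is -2, so that [refl i] negates the value at
    [i]. *)
Definition coef n : algC := zeta n + (zeta n)^-1.

Section Rep.
Variables (I : Type) (m : I -> I -> option nat).
Hypothesis cox : coxeter_matrix m.

(* The contragredient of the reflection representation: acting on all functions
   [I -> algC] avoids finite supports when [I] is infinite. *)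
Definition refl i (f : I -> algC) (k : I) : algC := f k + coef (m i k) * f i.

Lemma coef1 : coef (Some 1%N) = -2.
Proof.
have := zeta_prim 0; set z := zeta _ => zP.
have z2 : z ^+ 2 = 1 by apply: prim_expr_order zP.
have : (z - 1) * (z + 1) = 0 by rewrite -subr_sqr z2 expr1n subrr.
move/eqP; rewrite mulf_eq0 => /orP[|/eqP z1]; last first.
  have -> : coef (Some 1%N) = z + z^-1 by [].
  by rewrite (eqP (_ : z == -1)) ?addr_eq0 // -?addr_eq0 ?z1 // invrN1 -opprD.
rewrite subr_eq0 => /eqP z1.
by have := eq_prim_root_expr zP 1 0; rewrite z1 expr1n eqxx.
Qed.

Lemma coef_diag i : coef (m i i) = -2.
Proof. by have [_ _ m1] := cox; rewrite (m1 i i).2 // coef1. Qed.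

Lemma reflK i : involutive (refl i).
Proof.
by move=> f; apply/funext => k; rewrite /refl coef_diag; ring.
Qed.

Section Rank2.
Variables i j : I.
Local Notation z := (zeta (m i j)).
Local Notation c := (coef (m i j)).

Let cij : coef (m j i) = c. Proof. by have [-> _ _] := cox. Qed.

(** Both choices of [z'] are roots of [X^2 - c X + 1], which makes [f i + z' * f j] an eigenform of
    the product of the two reflections. *)
Lemma refl_eigen f z' : (z' = z \/ z' = z^-1) ->
  refl i (refl j f) i + z' * refl i (refl j f) j = z' ^+ 2 * (f i + z' * f j).
Proof.
move=> zz'; rewrite /refl !coef_diag cij.
have -> : c = z' + z'^-1.
  by rewrite /coef; case: zz' => ->; rewrite ?invrK // addrC.
have z'0 : z' != 0 by case: zz' => ->; rewrite ?invr_neq0 ?zeta_neq0.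
by field.
Qed.

Lemma foldr_refl_eigen f z' n : (z' = z \/ z' = z^-1) ->
  let g := foldr refl f (alt n.*2 i j) in
  g i + z' * g j = z' ^+ n.*2 * (f i + z' * f j).
Proof.
move=> zz' /=; elim: n => [|n IH]; first by rewrite expr0 mul1r.
by rewrite /= refl_eigen // IH mulrA -exprD.
Qed.

(* [a] and [b] solve the linear system saying that [f k + a * f i + b * f j] is
   fixed by both reflections; its determinant is [4 - c ^+ 2]. *)
Lemma foldr_refl_fix f k n : c ^+ 2 - 4 != 0 ->
  let a := (2 * coef (m i k) + c * coef (m j k)) / (4 - c ^+ 2) in
  let b := (2 * coef (m j k) + c * coef (m i k)) / (4 - c ^+ 2) in
  let g := foldr refl f (alt n.*2 i j) in
  g k + a * g i + b * g j = f k + a * f i + b * f j.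
Proof.
move=> c2 a b /=; elim: n => //= n <-; move: (foldr _ _ _) => {}f.
have c2' : 4 - c ^+ 2 != 0 by rewrite -opprB oppr_eq0.
by rewrite /a /b /refl !coef_diag cij; field.
Qed.

End Rank2.

(** After [2 n] letters both eigenforms are back at their start. For [n > 1] the roots [z] and
    [z^-1] differ, so the eigenforms determine the values at [i] and [j]; the fixed form then
    determines those at every [k]. *)
Lemma refl_braid i j n : m i j = Some n ->
  forall f, foldr refl f (alt n.*2 i j) = f.
Proof.
move=> mij f; have [ms m0 m1] := cox.
(* For [n = 1] the roots [z] and [z^-1] coincide, but then [i = j] and the word is a square. *)
have [n1|n1] := eqVneq n 1%N.
  by move: mij; rewrite n1 => /m1 <- /=; rewrite reflK.
case: n mij n1 => [|n] mij n1; first by have := m0 i j.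
pose z := zeta (m i j); have zP : (n.+1.*2).-primitive_root z.
  by rewrite /z mij; exact: zeta_prim.
have z0 : z != 0 := zeta_neq0 _.
have zz : z - z^-1 != 0.
  rewrite subr_eq0; apply/eqP => zV.
  have z2 : z ^+ 2 = 1 by rewrite expr2 {2}zV mulfV.
  have := prim_order_dvd zP 2; rewrite z2 eqxx => /(dvdn_leq (ltn0Sn 1)).
  by case: n n1 {mij zP}.
have zn : z ^+ n.+1.*2 = 1 := prim_expr_order zP.
have c2 : coef (m i j) ^+ 2 - 4 != 0.
  have -> : coef (m i j) ^+ 2 - 4 = (z - z^-1) ^+ 2.
    by rewrite /coef -/z; field.
  by rewrite expf_neq0.
have := foldr_refl_eigen f n.+1 (or_introl erefl : z = z \/ z = z^-1).
have := foldr_refl_eigen f n.+1 (or_intror erefl : z^-1 = z \/ z^-1 = z^-1).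
rewrite -/z; set g := foldr _ _ _ => /=.
rewrite exprVn zn invr1 !mul1r => e1 e2.
have gj : g j = f j.
  apply: (mulfI zz); rewrite !mulrBl.
  transitivity ((g i + z * g j) - (g i + z^-1 * g j)); first by ring.
  by rewrite e1 e2; ring.
have gi : g i = f i by move: e2; rewrite gj => /addIr.
apply/funext => k.
by have := foldr_refl_fix f k n.+1 c2; rewrite -/g /= gi gj => /addIr/addIr.
Qed.

Local Open Scope group_scope.

Lemma order_gen i j q : i <> j ->
  (coxeter_gen m i * coxeter_gen m j) ^+ q = 1 ->
  if m i j is Some n then (n %| q)%N else q == 0.
Proof.
move=> ij; rewrite -coxeter_word_alt_double -(coxeter_word_nil m) => e.
(* On the indicator function of [i] the eigenform has value 1, so a trivial power forces
   [zeta ^ (2 q) = 1]: either the entry divides [q], or [zeta = 2] and [q = 0]. *)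
pose f k : algC := (`[< k = i >])%:R%R.
have fi : f i = 1%R by rewrite /f asboolT.
have fj : f j = 0%R by rewrite /f asboolF // => /esym.
have := foldr_refl_eigen f q (or_introl (erefl (zeta (m i j)))).
rewrite (coxeter_act reflK refl_braid e) /= fi fj GRing.mulr0 GRing.addr0 GRing.mulr1.
case mij: (m i j) => [[|n]|].
- by have [_ /(_ i j)] := cox; rewrite mij.
- move/esym/eqP; rewrite -(prim_order_dvd (zeta_prim n)).
  by rewrite -!muln2 dvdn_pmul2r.
by move/esym/eqP; rewrite /= -natrX pnatr_eq1 (eqn_exp2l _ 0) // double_eq0.
Qed.

End Rep.
End Geometric.

(** * Inversions, the exchange condition and weak order *)

Section Exchange.
Variables (I : Type) (m : I -> I -> option nat).
Local Notation W := (coxeter_group m).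
Local Notation s := (coxeter_gen m).
Local Notation cw := (coxeter_word m).
Local Notation len := (@coxeter_length I m).
Implicit Types (i j : I) (u v : seq I) (w x y z t : W).

(* Folding [inv_step] along a word counts modulo 2 how often [t] occurs among
   the reflections of the word, so that the result only depends on the element. *)
Definition inv_step i (F : W -> bool) t : bool := (t == s i) (+) F (t ^ s i).

Lemma inv_stepK i : involutive (inv_step i).
Proof.
move=> F; apply/funext => t; rewrite /inv_step -conjgM coxeter_gen_sqr conjg1.
rewrite -(inj_eq (@conjg_inj W (s i)) t) addbA.
by rewrite [s i ^ s i]conjgE mulKg addbb.
Qed.

(** For [u = i1 ... in] these are the reflections [s_i1 ... s_ik ... s_i1], listed with
    repetitions. *)
Definition reflections u : seq W :=
  foldr (fun i r => s i :: [seq t ^ s i | t <- r]) [::] u.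

Lemma conjg_genK i : involutive (fun t : W => t ^ s i).
Proof. by move=> t; rewrite -conjgM coxeter_gen_sqr conjg1. Qed.

Lemma inv_stepE u F t :
  foldr inv_step F u t = odd (count_mem t (reflections u)) (+) F (t ^ cw u).
Proof.
elim: u t => [|i u IH] t; first by rewrite coxeter_word_nil conjg1.
rewrite /= /inv_step IH oddD oddb eq_sym coxeter_word_cons conjgM -!addbA.
congr (_ (+) (odd _ (+) _)).
rewrite count_map; apply: eq_count => x /=.
by rewrite -(inj_eq (@conjg_inj W (s i)) _ t) conjg_genK.
Qed.

Lemma reflections_alt n i j :
  reflections (alt n i j) = mkseq (fun k => cw (alt k.*2.+1 i j)) n.
Proof.
elim: n i j => //= n IH i j; rewrite IH /mkseq /=.
rewrite -[1%N]/(1 + 0) iotaDl -!map_comp coxeter_word1; congr (_ :: _).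
apply: eq_map => k /=.
have -> : i :: j :: i :: alt k.*2 j i = rcons (alt k.+1.*2 i j) i.
  by rewrite -[LHS]/(alt k.+1.*2.+1 i j) altS_rcons odd_double.
rewrite -cats1 coxeter_word_cat coxeter_word1 alt_doubleS !coxeter_word_cons.
by rewrite [LHS]conjgE coxeter_genV -!mulgA.
Qed.

(** As [(s i * s j) ^+ n = 1], the last [n] reflections of the word repeat the first [n], so every
    reflection occurs an even number of times. *)
Lemma inv_step_braid i j n : m i j = Some n ->
  forall F, foldr inv_step F (alt n.*2 i j) = F.
Proof.
move=> mij F; apply/funext => t.
have e : cw (alt n.*2 i j) = 1.
  by rewrite coxeter_word_alt_double (coxeter_braid mij).
rewrite inv_stepE e conjg1 reflections_alt -addnn /mkseq iotaD map_cat.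
have -> : iota (0 + n) n = [seq (n + k) | k <- iota 0 n].
  by rewrite -iotaDl addn0.
rewrite count_cat -map_comp.
rewrite (@eq_map _ _ (_ \o _) (fun k => cw (alt k.*2.+1 i j))); last first.
  move=> k; rewrite /comp doubleD -addnS alt_cat odd_double coxeter_word_cat e.
  by rewrite mul1g.
by rewrite addnn odd_double.
Qed.

Definition word_of w : seq I := projT1 (cid (coxeter_word_exists w)).

Lemma word_ofK w : cw (word_of w) = w.
Proof. by rewrite /word_of; case: cid. Qed.

Definition inversion w t : bool := foldr inv_step (fun=> false) (word_of w) t.

Lemma inversion_word u t :
  inversion (cw u) t = foldr inv_step (fun=> false) u t.
Proof.
rewrite /inversion (coxeter_act inv_stepK inv_step_braid (v := u)) //.
exact: word_ofK.
Qed.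

Lemma inversion1 t : inversion 1 t = false.
Proof. by rewrite -(coxeter_word_nil m) inversion_word. Qed.

Lemma inversion_gen i w t :
  inversion (s i * w) t = (t == s i) (+) inversion w (t ^ s i).
Proof. by rewrite -(word_ofK w) -coxeter_word_cons !inversion_word. Qed.

(** An odd count is positive, so [t] is the reflection of some letter of [u], and multiplying by [t]
    deletes that letter. *)
Lemma strong_exchange u t : inversion (cw u) t ->
  exists a i b, u = a ++ i :: b /\ t * cw u = cw (a ++ b).
Proof.
rewrite inversion_word; elim: u t => //= i u IH t.
rewrite /inv_step; have [->|_] := eqVneq t (s i).
  by exists [::], i, u; split; rewrite //= coxeter_word_cons coxeter_genK.
move/IH => [a [k [b [-> e]]]]; exists (i :: a), k, b; split=> //=.
rewrite !coxeter_word_cons -e conjgE coxeter_genV -!mulgA.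
by rewrite coxeter_genK.
Qed.

Lemma len_exists w : exists2 u, cw u = w & size u = len w.
Proof.
by rewrite /coxeter_length; case: ex_minnP => n /asboolP.
Qed.

Lemma len_word u : (len (cw u) <= size u).
Proof.
rewrite /coxeter_length; case: ex_minnP => n _; apply.
by apply/asboolP; exists u.
Qed.

Lemma len1 : len 1 = 0.
Proof. by apply/eqP; rewrite -leqn0 -(coxeter_word_nil m) len_word. Qed.

Lemma len_eq0 w : len w = 0 -> w = 1.
Proof.
by case: (len_exists w) => u <- <-; case: u => // _; apply: coxeter_word_nil.
Qed.

Lemma lenV w : len w^-1 = len w.
Proof.
suff le x : (len x^-1 <= len x).
  by apply/eqP; rewrite eqn_leq le /=; have := le w^-1; rewrite invgK.
have [u <- <-] := len_exists x.
by rewrite -coxeter_word_rev -(size_rev u) len_word.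
Qed.

Lemma lenM x y : (len (x * y) <= len x + len y).
Proof.
have [u <- <-] := len_exists x; have [v <- <-] := len_exists y.
by rewrite -coxeter_word_cat -size_cat len_word.
Qed.

Definition ldescent i w : bool := (len (s i * w) < len w).

Lemma len_gen_le i w : (len (s i * w) <= (len w).+1).
Proof.
apply: leq_trans (lenM _ _) _; rewrite -add1n leq_add2r.
by have := len_word [:: i]; rewrite coxeter_word1.
Qed.

Lemma inversion_ldescent i w : inversion w (s i) -> ldescent i w.
Proof.
have [u <- su] := len_exists w.
move=> /strong_exchange[a [k [b [uE e]]]]; rewrite /ldescent e -su uE.
by apply: leq_ltn_trans (len_word _) _; rewrite !size_cat addnS.
Qed.

(** The parity of [s i] differs between [w] and [s i * w], so [s i] is an inversion of exactly one
    of them, and an inversion forces the length to drop. *)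
Lemma ldescent_gen i w : ldescent i (s i * w) = ~~ ldescent i w.
Proof.
rewrite {1}/ldescent coxeter_genK.
case: (boolP (inversion w (s i))) => h.
  have := inversion_ldescent h; rewrite /ldescent => lt.
  by rewrite lt ltnNge ltnW.
have lt : (len w < len (s i * w)).
  rewrite -{1}(coxeter_genK i w); apply: inversion_ldescent.
  by rewrite inversion_gen eqxx [s i ^ s i]conjgE mulKg (negbTE h).
by rewrite lt /ldescent ltnNge ltnW.
Qed.

Lemma ldescentE i w : ldescent i w = inversion w (s i).
Proof.
apply/idP/idP => [|/inversion_ldescent //]; apply: contraLR => h.
rewrite -ldescent_gen; apply: inversion_ldescent.
by rewrite inversion_gen eqxx [s i ^ s i]conjgE mulKg (negbTE h).
Qed.

Lemma len_gen i w :
  if ldescent i w then len w = (len (s i * w)).+1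
  else len (s i * w) = (len w).+1.
Proof.
have lt x : ldescent i x -> len x = (len (s i * x)).+1.
  move=> h; apply/eqP; rewrite eqn_leq; apply/andP; split; last exact: h.
  by have := len_gen_le i (s i * x); rewrite coxeter_genK.
case: ifPn => [/lt //|]; rewrite -ldescent_gen => /lt.
by rewrite coxeter_genK.
Qed.

Lemma len_descent i w : ldescent i w -> len w = (len (s i * w)).+1.
Proof. by move=> h; have := len_gen i w; rewrite h. Qed.

Lemma len_ascent i w : ~~ ldescent i w -> len (s i * w) = (len w).+1.
Proof. by move=> /negbTE h; have := len_gen i w; rewrite h. Qed.

Lemma ldescent1 i : ldescent i 1 = false.
Proof. by rewrite /ldescent len1. Qed.

Lemma len_coxeter_gen i : len (s i) = 1%N.
Proof. by rewrite -[s i]mulg1 len_ascent ?ldescent1 ?len1. Qed.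

Lemma inversionM x y t : inversion (x * y) t = inversion x t (+) inversion y (t ^ x).
Proof.
rewrite -(word_ofK x); elim: (word_of x) t => [|i u IH] t.
  by rewrite coxeter_word_nil mul1g inversion1 conjg1.
by rewrite coxeter_word_cons -mulgA !inversion_gen IH conjgM addbA.
Qed.

(** By the cocycle rule [inversionM] the inversion must come from [y], and strong exchange deletes a
    letter of a reduced word of [y]. *)
Lemma ascent_exchange i x y : ~~ ldescent i x -> ldescent i (x * y) ->
  (len (s i ^ x * y) < len y).
Proof.
rewrite !ldescentE inversionM => /negbTE -> /=.
have [u <- su] := len_exists y.
move=> /strong_exchange[a [k [b [uE ->]]]]; rewrite -su uE.
by apply: leq_ltn_trans (len_word _) _; rewrite !size_cat addnS.
Qed.

Lemma exchange i u : ldescent i (cw u) ->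
  exists a k b, u = a ++ k :: b /\ s i * cw u = cw (a ++ b).
Proof. by rewrite ldescentE; apply: strong_exchange. Qed.

Definition is_reduced u := len (cw u) = size u.

Lemma reduced_cat u v : is_reduced (u ++ v) -> is_reduced u /\ is_reduced v.
Proof.
rewrite /is_reduced coxeter_word_cat size_cat => e.
have := lenM (cw u) (cw v); have := len_word u; have := len_word v.
rewrite e => lev leu le.
split; apply/eqP; rewrite eqn_leq ?lev ?leu /=.
  by rewrite -(leq_add2r (size v)); apply: leq_trans le _; rewrite leq_add2l.
by rewrite -(leq_add2l (size u)); apply: leq_trans le _; rewrite leq_add2r.
Qed.

Lemma reduced_cons i u : is_reduced (i :: u) ->
  is_reduced u /\ ~~ ldescent i (cw u).
Proof.
move=> red; have [_ redu] := reduced_cat (red : is_reduced ([:: i] ++ u)).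
split=> //; apply: contraT => /negPn/len_descent.
have := red; rewrite /is_reduced coxeter_word_cons redu /= => -> /eqP.
by rewrite -addn2 -{1}[size u]addn0 eqn_add2l.
Qed.

Lemma cons_reduced i u : is_reduced u -> ~~ ldescent i (cw u) -> is_reduced (i :: u).
Proof. by move=> red /len_ascent; rewrite /is_reduced coxeter_word_cons red. Qed.

Lemma reduced_exists w : exists2 u, cw u = w & is_reduced u.
Proof. by have [u <- su] := len_exists w; exists u. Qed.

Lemma descent_first w : w <> 1 -> exists i, ldescent i w.
Proof.
have [[|i u] <- red] := reduced_exists w; first by rewrite coxeter_word_nil.
exists i; have [_] := reduced_cons red.
by rewrite -ldescent_gen -coxeter_word_cons.
Qed.

(* Prefixes of reduced words: the left-divisibility order on simple elements. *)
Definition weak_le x w : bool := len x + len (x^-1 * w) == len w.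

Lemma weak_leP x w : reflect (len w = len x + len (x^-1 * w)) (weak_le x w).
Proof. by rewrite /weak_le eq_sym; apply: eqP. Qed.

Lemma weak_le_mul x y : (len (x * y) = len x + len y) -> weak_le x (x * y).
Proof. by move=> e; apply/weak_leP; rewrite mulKg. Qed.

Lemma weak_le_exists x w :
  weak_le x w -> exists2 y, w = x * y & len w = len x + len y.
Proof. by move/weak_leP => e; exists (x^-1 * w); rewrite ?mulVKg. Qed.

Lemma weak_le_refl w : weak_le w w.
Proof. by apply/weak_leP; rewrite mulVg len1 addn0. Qed.

Lemma weak_le1 w : weak_le 1 w.
Proof. by apply/weak_leP; rewrite invg1 mul1g len1. Qed.

Lemma weak_le_len x w : weak_le x w -> (len x <= len w).
Proof. by move/weak_leP => ->; apply: leq_addr. Qed.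

Lemma weak_le_trans y x w : weak_le x y -> weak_le y w -> weak_le x w.
Proof.
move=> /weak_leP xy /weak_leP yw; apply/weak_leP/eqP; rewrite eqn_leq.
rewrite -{1}(mulVKg x w) lenM /= yw xy -addnA leq_add2l.
by apply: leq_trans (lenM _ _); rewrite mulgA mulgK.
Qed.

Lemma weak_le_eq x w : weak_le x w -> (len w <= len x) -> x = w.
Proof.
move=> /weak_leP ->; rewrite -[X in (_ <= X)]addn0 leq_add2l leqn0.
by move=> /eqP/len_eq0/mulg1_eq; rewrite invgK.
Qed.

Lemma weak_le_anti x w : weak_le x w -> weak_le w x -> x = w.
Proof. by move=> xw /weak_le_len; apply: weak_le_eq. Qed.

Lemma weak_le_gen i w : weak_le (s i) w = ldescent i w.
Proof.
rewrite /weak_le coxeter_genV len_coxeter_gen add1n.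
apply/eqP/idP => [e|/len_descent //]; by rewrite /ldescent e.
Qed.

Lemma weak_le_ldescent i x w : weak_le x w -> ldescent i x -> ldescent i w.
Proof. by move=> xw; rewrite -!weak_le_gen => /weak_le_trans; apply. Qed.

Lemma weak_le_ascent i x w :
  ~~ ldescent i w -> weak_le x w -> weak_le (s i * x) (s i * w).
Proof.
move=> iw xw; have ix : ~~ ldescent i x by apply: contra iw; apply: weak_le_ldescent.
apply/weak_leP; rewrite !len_ascent // invgM coxeter_genV -mulgA coxeter_genK.
by rewrite (weak_leP _ _ xw) addSn.
Qed.

Lemma weak_le_descent i x w :
  ldescent i x -> weak_le x w -> weak_le (s i * x) (s i * w).
Proof.
move=> ix xw; have iw := weak_le_ldescent xw ix.
apply/weak_leP; rewrite invgM coxeter_genV -mulgA coxeter_genK.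
apply: succn_inj; rewrite -(len_descent iw) -addSn -(len_descent ix).
exact/weak_leP.
Qed.

(** The lifting property: since [i] is not a descent of [x], the exchange shortens the factor after
    [x], and the prefix [x] survives. *)
Lemma weak_le_drop i x w :
  ~~ ldescent i x -> ldescent i w -> weak_le x w -> weak_le x (s i * w).
Proof.
move=> ix iw xw; have [y wE lw] := weak_le_exists xw.
have := ascent_exchange ix (y := y); rewrite -wE => /(_ iw).
set y' := _ ^ x * y => ly.
have sw : s i * w = x * y' by rewrite wE /y' conjgE -!mulgA mulVKg.
rewrite sw; apply: weak_le_mul; apply/eqP; rewrite eqn_leq lenM /=.
by rewrite -ltnS -sw -(len_descent iw) lw -addnS leq_add2l.
Qed.

End Exchange.

(** * Standard parabolic subgroups *)

Section Parabolic.
Variables (I : Type) (m : I -> I -> option nat).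
Local Notation W := (coxeter_group m).
Local Notation s := (coxeter_gen m).
Local Notation cw := (coxeter_word m).
Local Notation len := (@coxeter_length I m).
Local Notation par := (@parabolic I m).
Implicit Types (i j : I) (u v : seq I) (w x y z t g : W) (J : set I).

Definition letters_in J u := all (fun i => `[< J i >]) u.

Lemma letters_in_cat J u v : letters_in J (u ++ v) = letters_in J u && letters_in J v.
Proof. exact: all_cat. Qed.

Lemma letters_in_rev J u : letters_in J (rev u) = letters_in J u.
Proof. exact: all_rev. Qed.

Lemma letters_in1 J j : letters_in J [:: j] <-> J j.
Proof. by rewrite /= andbT; split=> /asboolP. Qed.

Lemma letters_in_delete J a i b : letters_in J (a ++ i :: b) -> letters_in J (a ++ b).
Proof. by rewrite !letters_in_cat /= => /and3P[-> _ ->]. Qed.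

Lemma parabolicP J w :
  par J w <-> exists2 u, letters_in J u & cw u = w.
Proof.
split=> [|[u Ju <-]].
  apply: (smallest_sub (X := [set x | exists2 u, letters_in J u & cw u = x]%classic)).
    split=> [|x y /set_mem[u Ju <-] /set_mem[v Jv <-]]; apply/mem_set.
      by exists [::]; rewrite ?coxeter_word_nil.
    exists (u ++ rev v); rewrite ?coxeter_word_cat ?coxeter_word_rev //.
    by rewrite letters_in_cat letters_in_rev Ju.
  by move=> _ [j Jj <-]; exists [:: j]; rewrite ?coxeter_word1 //; apply/letters_in1.
move=> H [[/set_mem H1 HF] HJ].
have HV x : H x -> H x^-1.
  by move=> Hx; rewrite -div1g; apply/set_mem/HF; apply/mem_set.
elim: u Ju => [_|i u IH /= /andP[/asboolP Ji /IH Hu]].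
  by rewrite coxeter_word_nil.
rewrite coxeter_word_cons -[cw u]invgK; apply/set_mem/HF; apply/mem_set.
  by apply: HJ; exists i.
exact: HV.
Qed.

Lemma parabolic1 J : par J 1.
Proof. by apply/parabolicP; exists [::]; rewrite ?coxeter_word_nil. Qed.

Lemma parabolic_gen J j : J j -> par J (s j).
Proof.
by move=> Jj; apply/parabolicP; exists [:: j];
   rewrite ?coxeter_word1 //; apply/letters_in1.
Qed.

Lemma parabolicM J x y : par J x -> par J y -> par J (x * y).
Proof.
move=> /parabolicP[u Ju <-] /parabolicP[v Jv <-]; apply/parabolicP.
by exists (u ++ v); rewrite ?coxeter_word_cat ?letters_in_cat ?Ju.
Qed.

Lemma parabolicV J x : par J x -> par J x^-1.
Proof.
move=> /parabolicP[u Ju <-]; apply/parabolicP.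
by exists (rev u); rewrite ?coxeter_word_rev ?letters_in_rev.
Qed.

Lemma parabolicS J K x : (J `<=` K)%classic -> par J x -> par K x.
Proof.
move=> JK /parabolicP[u Ju <-]; apply/parabolicP; exists u => //.
by apply: sub_all Ju => i /asboolP/JK/asboolP.
Qed.

(** Shortening a word by the exchange condition only deletes letters, so it introduces none outside
    [J]. *)
Lemma parabolic_reduced J w : par J w ->
  exists u, [/\ letters_in J u, cw u = w & is_reduced m u].
Proof.
move=> /parabolicP[u Ju <-] {w}; elim: u Ju => [_|i u IH /= /andP[Ji /IH]].
  by exists [::]; rewrite /is_reduced coxeter_word_nil len1.
move=> [v [Jv e red]]; rewrite coxeter_word_cons -e.
case: (boolP (ldescent i (cw v))) => [iv|niv]; last first.
  exists (i :: v); rewrite coxeter_word_cons /= Ji Jv; split=> //.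
  by apply: cons_reduced.
have [a [k [b [vE e']]]] := exchange iv.
exists (a ++ b); split=> //.
  by move: Jv; rewrite vE; apply: letters_in_delete.
rewrite /is_reduced -e'; apply: succn_inj; rewrite -(len_descent iv) red vE.
by rewrite !size_cat addnS.
Qed.

Lemma parabolic_ind J (Q : W -> Prop) : Q 1 ->
  (forall j y, J j -> ~~ ldescent j y -> Q y -> Q (s j * y)) ->
  forall y, par J y -> Q y.
Proof.
move=> Q1 QS y /parabolic_reduced[u [Ju <- red]].
elim: u Ju red => [_ _|i u IH]; first by rewrite coxeter_word_nil.
rewrite /= => /andP[/asboolP Ji Ju] red; have [redu iu] := reduced_cons red.
by rewrite coxeter_word_cons; apply: QS => //; apply: IH.
Qed.

(** Letters are added in front: by [weak_le_drop] the element [y] lies below [s j * g], and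
    multiplying by [s j] brings [s j * y] below [g]. Upper bounds of a whole parabolic subgroup are
    thus recognised by their descents. *)
Lemma parabolic_weak_le J g : (forall j, J j -> ldescent j g) ->
  forall x, par J x -> weak_le x g.
Proof.
move=> Jg; apply: parabolic_ind => [|j y Jj jy yg]; first exact: weak_le1.
rewrite -(coxeter_genK j g); apply: weak_le_ascent.
  by rewrite ldescent_gen negbK Jg.
by apply: weak_le_drop => //; apply: Jg.
Qed.

(* If the right factor [s k] of [w = w' * s k] failed to lengthen [y * w'], the
   reflection [t] with [t * w' = w] would lie in the parabolic subgroup, and the
   induction hypothesis would make it a simple left descent of [w]. *)
Lemma parabolic_ascent J w : (forall j, J j -> ~~ ldescent j w) ->
  forall y, par J y -> len (y * w) = len y + len w.
Proof.
have [n] := ubnP (len w); elim: n w => // n IH w lw Jw y Jy.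
have [w1|/descent_first[k kw]] := pselect (w^-1 = 1).
  by rewrite -[w]invgK w1 invg1 mulg1 len1 addn0.
have [w' wE] : exists w', w = w' * s k.
  by exists (w * s k); rewrite -mulgA coxeter_gen_sqr mulg1.
have w'V : w'^-1 = s k * w^-1 by rewrite wE invgM coxeter_genV coxeter_genK.
have lw' : len w = (len w').+1 by rewrite -lenV -(lenV w') w'V; apply: len_descent.
have Jw' j : J j -> ~~ ldescent j w'.
  move=> Jj; apply: contra (Jw j Jj); apply: weak_le_ldescent.
  by rewrite wE; apply: weak_le_mul; rewrite -wE lw' len_coxeter_gen addn1.
have {}IH z : par J z -> len (z * w') = len z + len w'.
  by apply: IH => //; rewrite -ltnS -lw'.
rewrite lw' addnS -IH // -lenV -(lenV (y * w')).
have -> : (y * w)^-1 = s k * (y * w')^-1 by rewrite wE mulgA invgM coxeter_genV.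
apply: len_ascent; rewrite ldescentE invgM inversionM -ldescentE.
rewrite w'V ldescent_gen kw /= -w'V.
set t := s k ^ _; apply/negP => /= ht.
have tt : t * w' = w by rewrite /t conjgE invgK -!mulgA mulVg mulg1 -wE.
have Jt : par J t.
  have [u [Ju uE _]] := parabolic_reduced (parabolicV Jy).
  move: ht; rewrite -uE => /strong_exchange[a [i [b [u2 e]]]].
  have -> : t = cw (a ++ b) * (cw u)^-1 by rewrite -e mulgK.
  apply: parabolicM; last by apply: parabolicV; rewrite uE; apply: parabolicV.
  apply/parabolicP; exists (a ++ b) => //.
  by move: Ju; rewrite u2; apply: letters_in_delete.
have := IH t Jt; rewrite tt lw' -add1n => /addIn/esym lt.
have [u [Ju uE]] := parabolic_reduced Jt.
rewrite /is_reduced uE lt; case: u Ju uE => [|j [|//]] //= /andP[/asboolP Jj _].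
rewrite coxeter_word1 => tj _.
by have := Jw j Jj; rewrite -tt -tj ldescent_gen Jw'.
Qed.

End Parabolic.

(** * Alternating products of two elements *)

Section AlternatingProducts.

Definition alt_prod (M : monoidType) n (x y : M) : M := \prod_(c <- alt n x y) c.

Lemma alt_prodS (M : monoidType) n (x y : M) : alt_prod n.+1 x y = x * alt_prod n y x.
Proof. by rewrite /alt_prod big_cons. Qed.

Lemma alt_prod0 (M : monoidType) (x y : M) : alt_prod 0 x y = 1.
Proof. by rewrite /alt_prod big_nil. Qed.

Lemma map_alt (X Y : Type) (f : X -> Y) n i j : map f (alt n i j) = alt n (f i) (f j).
Proof. by elim: n i j => //= n IH i j; rewrite IH. Qed.

Lemma alt_prod_map (X : Type) (M : monoidType) (f : X -> M) n i j :
  \prod_(k <- alt n i j) f k = alt_prod n (f i) (f j).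
Proof. by rewrite -(big_map f xpredT id) map_alt. Qed.

Lemma alt_prod_eq (G : groupType) n (x y : G) : x * x = 1 -> y * y = 1 ->
  alt_prod n x y = alt_prod n y x <-> (x * y) ^+ n = 1.
Proof.
move=> /mulg1_eq xV /mulg1_eq yV.
have V : (alt_prod n y x)^-1 = \prod_(c <- rev (alt n y x)) c.
  rewrite /alt_prod; elim: n x y xV yV => [|n IH] x y xV yV.
    by rewrite !big_nil invg1.
  by rewrite /= rev_cons -cats1 big_cat big_cons big_seq1 invgM yV -IH.
have -> : (x * y) ^+ n = alt_prod n x y * (alt_prod n y x)^-1.
  rewrite V -big_cat -alt_double -/(alt_prod _ _ _); elim: n {V} => [|n IH].
    by rewrite alt_prod0.
  by rewrite expgS IH doubleS !alt_prodS mulgA.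
by split=> [->|/divg1_eq //]; rewrite mulgV.
Qed.

(** The length of [alt_prod n x y] when lengths add, for [x] and [y] of lengths [p] and [q]. *)
Definition alt_sum n p q := sumn (alt n p q).

Lemma alt_sum_lt n p q : 0 < p -> 0 < q -> alt_sum n p q < alt_sum n.+1 p q.
Proof.
elim: n p q => [|n IH] p q p0 q0; rewrite /alt_sum /= ?addn0 //.
by rewrite ltn_add2l; apply: IH.
Qed.

Lemma alt_sum_ge n p q : 0 < p -> 0 < q -> n <= alt_sum n p q.
Proof.
move=> p0 q0; elim: n => // n /leq_ltn_trans; apply; exact: alt_sum_lt.
Qed.

Lemma alt_sum1 n : alt_sum n 1%N 1%N = n.
Proof. by elim: n => //= n; rewrite /alt_sum /= => ->. Qed.

End AlternatingProducts.

(** * Dihedral behaviour of two blocks *)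

Section Dihedral.
Variables (I : Type) (m : I -> I -> option nat).
Local Notation W := (coxeter_group m).
Local Notation len := (@coxeter_length I m).
Local Notation par := (@parabolic I m).
Implicit Types (a b J : set I) (g w x y : W).

Definition descents_on J w := forall j, J j -> ldescent j w.
Definition ascents_on J w := forall j, J j -> ~~ ldescent j w.

(** Stated through descents, so that a generator over a singleton and [longest] over a part of the
    partition are treated alike. *)
Record is_block a (r : W) : Prop := IsBlock {
  block_par : par a r;
  block_desc : descents_on a r;
  block_sqr : r * r = 1;
  block_neq1 : r <> 1 }.

Lemma block_len_gt0 a r : is_block a r -> 0 < len r.
Proof. by case=> _ _ _ r1; rewrite lt0n; apply/eqP => /len_eq0. Qed.

Lemma weak_le_descents_on a x y : weak_le x y -> descents_on a x -> descents_on a y.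
Proof. by move=> xy ax j /ax; apply: weak_le_ldescent. Qed.

Lemma len_alt_prod n x y : len (alt_prod n x y) <= alt_sum n (len x) (len y).
Proof.
elim: n x y => [|n IH] x y; first by rewrite alt_prod0 len1.
rewrite alt_prodS; apply: leq_trans (lenM _ _) _.
by rewrite /alt_sum /= leq_add2l IH.
Qed.

Lemma len_alt_prodS n x y :
  len (alt_prod n.+1 x y) = alt_sum n.+1 (len x) (len y) ->
  len (alt_prod n y x) = alt_sum n (len y) (len x) /\
  weak_le x (alt_prod n.+1 x y).
Proof.
move=> e; have e1 : len (alt_prod n y x) = alt_sum n (len y) (len x).
  apply/eqP; rewrite eqn_leq len_alt_prod /=.
  rewrite -(leq_add2l (len x)) -[X in X <= _]/(alt_sum n.+1 (len x) (len y)) -e.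
  by rewrite alt_prodS lenM.
by split=> //; move: e; rewrite alt_prodS => e; apply: weak_le_mul; rewrite e e1.
Qed.

(* Also applied to two singletons, where the compatibility hypotheses are void. *)
Section TwoBlocks.
Variables (a b : set I) (ra rb : W).
Hypotheses (Ba : is_block a ra) (Bb : is_block b rb).
Hypothesis compat_a : forall n,
  descents_on a (alt_prod n rb ra) \/ ascents_on a (alt_prod n rb ra).
Hypothesis compat_b : forall n,
  descents_on b (alt_prod n ra rb) \/ ascents_on b (alt_prod n ra rb).

Local Notation A n := (alt_prod n ra rb).
Local Notation B n := (alt_prod n rb ra).
Local Notation ab := (a `|` b)%classic.

Let additive n := len (A n) = alt_sum n (len ra) (len rb) /\
  len (B n) = alt_sum n (len rb) (len ra).

Let parA n : par ab (A n) /\ par ab (B n).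
Proof.
elim: n => [|n [IHA IHB]]; first by rewrite !alt_prod0; split; apply: parabolic1.
rewrite !alt_prodS; split; apply: parabolicM => //.
  by apply: parabolicS (block_par Ba) => i; left.
by apply: parabolicS (block_par Bb) => i; right.
Qed.

Let additiveS_desc n : additive n.+1 ->
  descents_on a (A n.+1) /\ descents_on b (B n.+1).
Proof.
move=> [/len_alt_prodS[_ leA] /len_alt_prodS[_ leB]]; split.
  exact: weak_le_descents_on leA (block_desc Ba).
exact: weak_le_descents_on leB (block_desc Bb).
Qed.

(** By compatibility, lengths add once more unless one of the two products has both blocks as
    descents and so dominates [par ab]. If both did, they would be equal; if only one did, it would
    dominate a product with one more factor, which is longer. *)
Let additiveS n : additive n.+1 -> A n.+1 <> B n.+1 -> additive n.+2.
Proof.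
move=> add neq; have [aA bB] := additiveS_desc add.
have [pA pB] := parA n.+1; have [pA2 pB2] := parA n.+2.
have la := block_len_gt0 Ba; have lb := block_len_gt0 Bb.
have lA : ascents_on a (B n.+1) ->
    len (A n.+2) = alt_sum n.+2 (len ra) (len rb).
  move=> /parabolic_ascent/(_ _ (block_par Ba)); rewrite -alt_prodS => ->.
  by rewrite (add.2).
have lB : ascents_on b (A n.+1) ->
    len (B n.+2) = alt_sum n.+2 (len rb) (len ra).
  move=> /parabolic_ascent/(_ _ (block_par Bb)); rewrite -alt_prodS => ->.
  by rewrite (add.1).
have topA : descents_on b (A n.+1) -> forall x, par ab x -> weak_le x (A n.+1).
  by move=> bA; apply: parabolic_weak_le => j [/aA|/bA].
have topB : descents_on a (B n.+1) -> forall x, par ab x -> weak_le x (B n.+1).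
  by move=> aB; apply: parabolic_weak_le => j [/aB|/bB].
case: (compat_b n.+1) => [dA|/lB eB]; case: (compat_a n.+1) => [dB|/lA eA] //.
- by case: neq; apply: weak_le_anti; [apply: topB|apply: topA].
- have := weak_le_len (topA dA _ pA2); rewrite eA (add.1) leqNgt.
  by rewrite alt_sum_lt.
- have := weak_le_len (topB dB _ pB2); rewrite eB (add.2) leqNgt.
  by rewrite alt_sum_lt.
Qed.

Let additive_until n : (forall q, 0 < q < n -> A q <> B q) -> additive n.
Proof.
elim: n => [|[|n] IH] neq; first by rewrite /additive !alt_prod0 len1.
  by rewrite /additive !alt_prodS !alt_prod0 !mulg1 /alt_sum /= !addn0.
apply: additiveS; last by apply: neq; rewrite ltnSn.
by apply: IH => q /andP[q0 qn]; apply: neq; rewrite q0 ltnW.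
Qed.

(** The two products differ below the order, so lengths add up to it; there [A n] equals [B n] and
    inherits the descents of both. *)
Lemma two_blocks_order n : 0 < n -> (ra * rb) ^+ n = 1 ->
  (forall q, 0 < q -> (ra * rb) ^+ q = 1 -> n <= q) ->
  [/\ A n = B n, len (A n) = alt_sum n (len ra) (len rb),
      len (B n) = alt_sum n (len rb) (len ra) & descents_on ab (A n)].
Proof.
have AB q := alt_prod_eq q (block_sqr Ba) (block_sqr Bb).
case: n => // n _ /AB e least.
have [q /andP[q0 qn] /AB/(least q q0)|lA lB] := additive_until (n := n.+1).
  by rewrite leqNgt qn.
have [aA bB] := additiveS_desc (conj lA lB).
by split=> // j [/aA//|]; rewrite e => /bB.
Qed.

(** With infinite order lengths would add forever, and some alternating product would outgrow [g],
    which dominates them all. *)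
Lemma two_blocks_finite g : descents_on ab g ->
  exists2 n, 0 < n & (ra * rb) ^+ n = 1.
Proof.
move=> /parabolic_weak_le top; apply: contrapT => infinite.
have [|lA _] := additive_until (n := (len g).+1).
  move=> q /andP[q0 _] /(alt_prod_eq q (block_sqr Ba) (block_sqr Bb)) e.
  by case: infinite; exists q.
have [pA _] := parA (len g).+1.
have := weak_le_len (top _ pA); rewrite lA leqNgt => /negP; apply.
by apply: alt_sum_ge; [apply: block_len_gt0 Ba|apply: block_len_gt0 Bb].
Qed.

End TwoBlocks.
End Dihedral.

(** * Orders of group elements *)

Section Order.
Variable G : groupType.
Implicit Type x : G.

Lemma elt_order_some x n : elt_order x = Some n ->
  [/\ 0 < n, x ^+ n = 1 & forall q, 0 < q -> x ^+ q = 1 -> n <= q].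
Proof.
rewrite /elt_order; case: pselect => // h [<-].
case: ex_minnP => k /andP[k0 /eqP xk] least; split=> // q q0 xq.
by apply: least; rewrite q0 xq eqxx.
Qed.

Lemma elt_order_none x n : elt_order x = None -> 0 < n -> x ^+ n <> 1.
Proof.
rewrite /elt_order; case: pselect => // h _ n0 xn; case: h.
by exists n; rewrite n0 xn eqxx.
Qed.

Lemma elt_orderE x n : 0 < n -> x ^+ n = 1 ->
  (forall q, 0 < q -> x ^+ q = 1 -> n <= q) -> elt_order x = Some n.
Proof.
move=> n0 xn least; case e: (elt_order x) => [k|].
  have [k0 xk leastk] := elt_order_some e.
  by congr Some; apply/eqP; rewrite eqn_leq leastk // least.
by case: (elt_order_none e n0).
Qed.

Lemma elt_orderV x : elt_order x^-1 = elt_order x.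
Proof.
have V q : (x^-1 ^+ q = 1) <-> (x ^+ q = 1).
  by rewrite expVgn; split=> [/eqP|->]; rewrite ?invg1 // invg_eq1 => /eqP.
case e: (elt_order x) => [n|].
  have [n0 xn least] := elt_order_some e.
  by apply: elt_orderE => //; [apply/V|move=> q q0 /V; apply: least].
case e': (elt_order _) => [n|//]; have [n0 /V xn _] := elt_order_some e'.
by case: (elt_order_none e n0).
Qed.

Lemma elt_order1P x : elt_order x = Some 1%N <-> x = 1.
Proof.
split=> [/elt_order_some[_]|->]; first by rewrite expg1.
by apply: elt_orderE => //; rewrite expg1.
Qed.

End Order.

(** * Meets in weak order, and Matsumoto's theorem *)

Section Matsumoto.
Variables (I : Type) (m : I -> I -> option nat).
Hypothesis cox : coxeter_matrix m.
Local Notation W := (coxeter_group m).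
Local Notation s := (coxeter_gen m).
Local Notation cw := (coxeter_word m).
Local Notation len := (@coxeter_length I m).
Local Notation par := (@parabolic I m).
Implicit Types (i j : I) (u v : seq I) (w x y z g : W) (J : set I).

Lemma singleton_block i : is_block [set i]%classic (s i).
Proof.
split; [exact: parabolic_gen| |exact: coxeter_gen_sqr|].
  by move=> _ ->; rewrite -[s i]mulg1 ldescent_gen ldescent1.
by move=> e; have := len_coxeter_gen m i; rewrite e len1.
Qed.

Lemma singleton_compat i w :
  descents_on [set i]%classic w \/ ascents_on [set i]%classic w.
Proof. by case: (boolP (ldescent i w)) => h; [left|right] => _ ->. Qed.

Lemma alt_prod_gen n i j : cw (alt n i j) = alt_prod n (s i) (s j).
Proof. exact: alt_prod_map. Qed.

Lemma braid_word i j n : i <> j -> m i j = Some n ->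
  [/\ is_reduced m (alt n i j), cw (alt n i j) = cw (alt n j i) &
      descents_on [set i; j]%classic (cw (alt n i j))].
Proof.
move=> ij mij; have [_ /(_ i j) m0 _] := cox.
have n0 : 0 < n by case: n m0 mij => // m0 /m0.
(* The presentation only bounds the order by [n]; the representation excludes its proper
   divisors. *)
have least q : 0 < q -> (s i * s j) ^+ q = 1 -> n <= q.
  by move=> q0 /(Geometric.order_gen cox ij); rewrite mij => /dvdn_leq; apply.
have := two_blocks_order (singleton_block i) (singleton_block j)
    (fun n => singleton_compat _ _) (fun n => singleton_compat _ _) n0
    (coxeter_braid mij) least.
rewrite -!alt_prod_gen => -[e]; rewrite !len_coxeter_gen alt_sum1 => lA _ dA.
by rewrite /is_reduced size_alt.
Qed.

Lemma letters_in_alt J n i j : J i -> J j -> letters_in J (alt n i j).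
Proof.
by elim: n i j => //= n IH i j Ji Jj; rewrite IH // asboolT.
Qed.

(** The element [g] bounds the alternating products of [s i] and [s j], which makes [m i j]
    finite. *)
Lemma braid_weak_le i j g : i <> j -> ldescent i g -> ldescent j g ->
  exists2 n, m i j = Some n & weak_le (cw (alt n i j)) g.
Proof.
move=> ij ig jg; have dg : descents_on [set i; j]%classic g by move=> _ [] ->.
have [n n0 sn] := two_blocks_finite (singleton_block i) (singleton_block j)
  (fun n => singleton_compat _ _) (fun n => singleton_compat _ _) dg.
have := Geometric.order_gen cox ij sn.
case mij: (m i j) => [k|]; last by rewrite eqn0Ngt n0.
exists k => //; apply: parabolic_weak_le dg _ _; apply/parabolicP.
by exists (alt k i j) => //; apply: letters_in_alt; [left|right].
Qed.

(* The greatest lower bounds among elements with a given left descent [i] agree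
   for all common descents [i] of [x] and [y]: the top of the dihedral subgroup
   of [i] and [j] lies below both. *)
Lemma weak_meet x y : exists z, [/\ weak_le z x, weak_le z y &
  forall t, weak_le t x -> weak_le t y -> weak_le t z].
Proof.
have [n] := ubnP (len x); elim: n x y => // n IH x y lx.
have meet i : ldescent i x -> ldescent i y -> exists z, [/\ ldescent i z,
    weak_le z x, weak_le z y &
    forall t, ldescent i t -> weak_le t x -> weak_le t y -> weak_le t z].
  move=> ix iy; have [|z [zx zy top]] := IH (s i * x) (s i * y).
    by rewrite -ltnS -(len_descent ix).
  have iz : ~~ ldescent i z.
    by apply/negP => /(weak_le_ldescent zx); rewrite ldescent_gen ix.
  have le t : weak_le z (s i * t) -> ldescent i t -> weak_le (s i * z) t.
    move=> zt it; rewrite -(coxeter_genK i t); apply: weak_le_ascent => //.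
    by rewrite ldescent_gen it.
  exists (s i * z); split; rewrite ?ldescent_gen //; try exact: le.
  move=> t it tx ty; rewrite -(coxeter_genK i t); apply: weak_le_ascent => //.
  by apply: top; apply: weak_le_descent.
have [[i [ix iy]]|no] := pselect (exists i, ldescent i x /\ ldescent i y); last first.
  exists 1; rewrite !weak_le1; split=> // t tx ty.
  have [->|/descent_first[i it]] := pselect (t = 1); first exact: weak_le1.
  by case: no; exists i; split; [apply: weak_le_ldescent tx it|
                                 apply: weak_le_ldescent ty it].
have [z [iz zx zy top]] := meet i ix iy; exists z; split=> // t tx ty.
have [->|/descent_first[j jt]] := pselect (t = 1); first exact: weak_le1.
have [ij|ij] := pselect (i = j); first by apply: top; rewrite // ij.
have jx := weak_le_ldescent tx jt; have jy := weak_le_ldescent ty jt.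
have [z' [jz' z'x z'y top']] := meet j jx jy.
have [n' mij rx] := braid_weak_le ij ix jx.
have [n'' mij' ry] := braid_weak_le ij iy jy.
move: mij' ry; rewrite mij => -[<-] ry {n''}.
have [_ _ dr] := braid_word ij mij.
have jz : ldescent j z.
  apply: (weak_le_ldescent (top _ _ rx ry)); apply: dr; first by left.
  by right.
by apply: weak_le_trans (top' _ jt tx ty) _; apply: top => //;
   apply: (weak_le_ldescent (top' _ _ rx ry)); apply: dr; [right|left].
Qed.

(* By [weak_le_drop], the meet of [w] and [s i * w] does the job. *)
Lemma weak_avoid i w : exists z, [/\ weak_le z w, ~~ ldescent i z &
  forall t, ~~ ldescent i t -> weak_le t w -> weak_le t z].
Proof.
case: (boolP (ldescent i w)) => iw; last first.
  by exists w; rewrite weak_le_refl.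
have [z [zw zsw top]] := weak_meet w (s i * w); exists z; split=> //.
  by apply/negP => /(weak_le_ldescent zsw); rewrite ldescent_gen iw.
by move=> t it tw; apply: top => //; apply: weak_le_drop.
Qed.

(** Words with the same first letter are compared through their tails. For first letters [i] and
    [j], both words are linked through [alt k i j ++ w] and [alt k j i ++ w], which exist because
    the dihedral top lies below the common element. *)
Lemma matsumoto u v : is_reduced m u -> is_reduced m v -> cw u = cw v ->
  cong (braid_rel m) u v.
Proof.
have [n] := ubnP (size u); elim: n u v => // n IH [|i u] [|j v] su ru rv uv.
- exact: cong_refl.
- by have := rv; rewrite /is_reduced -uv coxeter_word_nil len1.
- by have := ru; rewrite /is_reduced uv coxeter_word_nil len1.
have {}IH k u' v' : size u' = (size u).+1 -> is_reduced m u' -> is_reduced m v' ->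
    cw u' = cw v' -> ohead u' = Some k -> ohead v' = Some k ->
    cong (braid_rel m) u' v'.
  case: u' v' => [//|p u'] [//|q v'] /= [su'] ru' rv' + [pk] [qk]; subst p q.
  have [ru1 _] := reduced_cons ru'; have [rv1 _] := reduced_cons rv'.
  rewrite !coxeter_word_cons => /mulgI uv'.
  have := cong_ctx [:: k] [::] (IH u' v' _ ru1 rv1 uv'); rewrite /= !cats0; apply.
  by rewrite su'.
have [ij|ij] := pselect (i = j).
  by apply: (IH i) => //=; rewrite ij.
have desc k t : is_reduced m (k :: t) -> ldescent k (cw (k :: t)).
  by move=> red; have [_] := reduced_cons red; rewrite coxeter_word_cons ldescent_gen.
have jd := desc _ _ rv; rewrite -uv in jd.
have [k mij le] := braid_weak_le ij (desc _ _ ru) jd.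
have [ra ab _] := braid_word ij mij.
have [y uE lu] := weak_le_exists le; have [w wE rw] := reduced_exists y.
have size_kw : (k + size w)%N = (size u).+1.
  by rewrite -rw wE -[k](size_alt k i j) -ra -lu ru.
have k0 : 0 < k by case: (k) mij; have [_ /(_ i j)] := cox.
have redu : is_reduced m (alt k i j ++ w).
  by rewrite /is_reduced coxeter_word_cat wE -uE ru size_cat size_alt size_kw.
have redv : is_reduced m (alt k j i ++ w).
  by rewrite /is_reduced coxeter_word_cat -ab wE -uE ru size_cat size_alt size_kw.
have headE p q : ohead (alt k p q ++ w) = Some p by case: (k) k0.
apply: (@cong_trans _ _ _ (alt k i j ++ w)).
  by apply: (IH i) => //=; rewrite coxeter_word_cat wE.
apply: (@cong_trans _ _ _ (alt k j i ++ w)).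
  exact: (cong_rel [::] w (braid_rel_intro mij)).
apply: (IH j) => //=; first by rewrite size_cat size_alt.
by rewrite coxeter_word_cat -ab wE -uE.
Qed.

End Matsumoto.

(** * Artin-Tits monoids *)

Section PresentedMorphism.
Variables (X : Type) (R : seq X -> seq X -> Prop) (M : monoidType) (f : X -> M).
Hypothesis fR : forall u v, R u v -> \prod_(i <- u) f i = \prod_(i <- v) f i.

Definition pres_map (x : pres_monoid R) : M := \prod_(i <- pres_repr x) f i.

Lemma cong_prod u v : cong R u v -> \prod_(i <- u) f i = \prod_(i <- v) f i.
Proof.
elim=> {u v} [a b u v /fR e|//|u v _ ->//|u v w _ -> _ ->//].
by rewrite !big_cat /= e.
Qed.

Lemma pres_map_class u : pres_map (pres_class R u) = \prod_(i <- u) f i.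
Proof.
exact/cong_prod/pres_classP/pres_reprK.
Qed.

Lemma pres_map_morphism : monoid_morphism pres_map.
Proof.
split=> [|x y]; first by rewrite pres_map_class big_nil.
rewrite -(pres_reprK x) -(pres_reprK y) -pres_classM !pres_map_class.
by rewrite big_cat.
Qed.

End PresentedMorphism.

(** * Cancellation and greatest simple divisors in the Artin-Tits monoid *)

Section ArtinMonoid.
Variables (I : Type) (m : I -> I -> option nat).
Local Notation B := (artin_monoid m).
Local Notation gen := (artin_gen m).
Implicit Types (i j : I) (u v : seq I) (x y z : B).

Definition artin_word u : B := pres_class (braid_rel m) u.
Local Notation aw := artin_word.

Lemma artin_word_cat u v : aw (u ++ v) = aw u * aw v.
Proof. exact: pres_classM. Qed.

Lemma artin_word_cons i u : aw (i :: u) = gen i * aw u.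
Proof. by rewrite -cat1s artin_word_cat. Qed.

Lemma artin_word_nil : aw [::] = 1.
Proof. by []. Qed.

Lemma artin_word_exists x : exists u, aw u = x.
Proof. by exists (pres_repr x); apply: pres_reprK. Qed.

Lemma artin_word_alt i j n : m i j = Some n -> aw (alt n i j) = aw (alt n j i).
Proof.
move=> mij; apply/pres_classP.
by have := cong_rel [::] [::] (braid_rel_intro mij); rewrite /= !cats0.
Qed.

Lemma cong_size u v : cong (braid_rel m) u v -> size u = size v.
Proof.
elim=> {u v} [a b u v [i j n _]|//|//|u v w _ -> _ -> //].
by rewrite !size_cat !size_alt.
Qed.

(** Braid relations preserve size, so the chosen representative does not matter. *)
Definition artin_length x := size (pres_repr x).
Local Notation alen := artin_length.

Lemma artin_length_word u : alen (aw u) = size u.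
Proof. by apply/cong_size/pres_classP/pres_reprK. Qed.

Lemma artin_lengthM x y : alen (x * y) = alen x + alen y.
Proof.
have [u <-] := artin_word_exists x; have [v <-] := artin_word_exists y.
by rewrite -artin_word_cat !artin_length_word size_cat.
Qed.

Lemma artin_length_gen i : alen (gen i) = 1%N.
Proof. exact: (artin_length_word [:: i]). Qed.

Lemma artin_length1 : alen 1 = 0.
Proof. exact: (artin_length_word [::]). Qed.

Lemma artin_length_eq0 x : alen x = 0 -> x = 1.
Proof.
have [u <-] := artin_word_exists x.
by rewrite artin_length_word => /size0nil ->.
Qed.

Lemma artin_first x : x = 1 \/ exists i y, x = gen i * y.
Proof.
have [[|i u] <-] := artin_word_exists x; [by left|right].
by exists i, (aw u); rewrite artin_word_cons.
Qed.

Lemma left_dvd_trans (M : monoidType) (y x z : M) :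
  left_dvd x y -> left_dvd y z -> left_dvd x z.
Proof. by move=> [p ->] [q ->]; exists (p * q); rewrite mulgA. Qed.

Lemma left_dvd_anti x y : left_dvd x y -> left_dvd y x -> x = y.
Proof.
move=> [p yE] [q xE]; have := congr1 alen xE; rewrite yE !artin_lengthM -addnA.
rewrite -[X in X = _]addn0 => /eqP; rewrite eqn_add2l eq_sym addn_eq0.
by move=> /andP[/eqP/artin_length_eq0 -> _]; rewrite mulg1.
Qed.

Hypothesis cox : coxeter_matrix m.
Local Notation W := (coxeter_group m).
Local Notation s := (coxeter_gen m).
Local Notation cw := (coxeter_word m).
Local Notation len := (@coxeter_length I m).
Local Notation lift := (@artin_lift I m).
Implicit Types (w g : W).

Lemma artin_lift_word u : is_reduced m u -> lift (cw u) = aw u.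
Proof.
move=> ru; rewrite /artin_lift; apply/pres_classP; case: xgetP => [v _ [e rv]|].
  by apply: (matsumoto cox) => //; rewrite /is_reduced e rv.
(* The default word is never chosen, as [u] itself is a reduced word. *)
by move/(_ u); case; split.
Qed.

Lemma artin_lift1 : lift 1 = 1.
Proof.
by rewrite -(coxeter_word_nil m) artin_lift_word // /is_reduced coxeter_word_nil len1.
Qed.

Lemma artin_lift_gen i : lift (s i) = gen i.
Proof.
by rewrite -coxeter_word1 artin_lift_word // /is_reduced coxeter_word1 len_coxeter_gen.
Qed.

Lemma artin_liftM (x y : W) :
  len (x * y) = len x + len y -> lift (x * y) = lift x * lift y.
Proof.
have [u <- ru] := reduced_exists x; have [v <- rv] := reduced_exists y.
rewrite -coxeter_word_cat ru rv -size_cat => e.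
by rewrite !artin_lift_word // artin_word_cat.
Qed.

Lemma artin_length_lift w : alen (lift w) = len w.
Proof.
have [u <- ru] := reduced_exists w.
by rewrite artin_lift_word // artin_length_word.
Qed.

Lemma weak_le_dvd (x y : W) : weak_le x y -> left_dvd (lift x) (lift y).
Proof. by move=> /weak_le_exists[z -> e]; exists (lift z); apply: artin_liftM. Qed.

Lemma artin_lift_descent i w : ldescent i w -> lift w = gen i * lift (s i * w).
Proof.
move=> iw; rewrite -artin_lift_gen -artin_liftM ?coxeter_genK //.
by rewrite len_coxeter_gen add1n -len_descent.
Qed.

Lemma weak_le_word u g : is_reduced m u -> weak_le (cw u) g ->
  exists2 d, is_reduced m (u ++ d) & cw (u ++ d) = g.
Proof.
move=> ru /weak_le_exists[y gE lg]; have [d dE rd] := reduced_exists y.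
exists d; rewrite ?coxeter_word_cat ?dE // /is_reduced coxeter_word_cat dE -gE.
by rewrite lg ru -dE rd size_cat.
Qed.

(* [gen i * x = gen j * y] because both are multiples of the lcm of [gen i] and
   [gen j]. *)
Definition completes i x j y := (i = j /\ x = y) \/ (i <> j /\
  exists n z, [/\ m i j = Some n.+1, x = aw (alt n j i) * z & y = aw (alt n i j) * z]).

(** The induction statement: it covers equal products of length at most [L], which is enough to work
    with elements of that length and to reach [L.+1]. *)
Definition completion L := forall i j x y, alen x < L -> gen i * x = gen j * y ->
  completes i x j y.

Lemma completes_sym i x j y : completes i x j y -> completes j y i x.
Proof.
case=> [[-> ->]|[ij [n [z [mij -> ->]]]]]; first by left.
right; split; first by move/esym.
by exists n, z; have [<- _ _] := cox.
Qed.

Section BelowLength.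
Variable L : nat.
Hypothesis HL : completion L.

Lemma cancel_below p x y : alen (p * x) <= L -> p * x = p * y -> x = y.
Proof.
have [u <-] := artin_word_exists p; elim: u x y => [|i u IH] x y.
  by rewrite artin_word_nil !mul1g.
rewrite artin_word_cons -!mulgA artin_lengthM artin_length_gen add1n => lt e.
by case: (HL lt e) => [[_]|[]//]; apply: IH; apply: ltnW.
Qed.

(** If [x = gen i * y], the greatest simple divisor of [x] with descent [i] is [s i * z], where [z]
    is the greatest element without descent [i] below the greatest simple divisor of [y]. The
    candidates for two first letters agree, because the lcm of these letters divides [x] and has
    both as descents. *)
Lemma max_simple_below x : alen x <= L -> exists2 w, left_dvd (lift w) x &
  forall t, left_dvd (lift t) x -> weak_le t w.
Proof.
have [n] := ubnP (alen x); elim: n x => // n IH x lx xL.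
have maxi i : left_dvd (gen i) x -> exists w, [/\ ldescent i w, left_dvd (lift w) x &
    forall t, ldescent i t -> left_dvd (lift t) x -> weak_le t w].
  move=> [y xE]; have lxy : alen x = (alen y).+1.
    by rewrite xE artin_lengthM artin_length_gen.
  have [||w [q yE] top] := IH y; [by rewrite -ltnS -lxy|by rewrite ltnW // -lxy|].
  have [z [zw iz topz]] := weak_avoid cox i w.
  exists (s i * z); split; first by rewrite ldescent_gen.
    rewrite (@artin_lift_descent i) ?ldescent_gen // coxeter_genK.
    have [p zp] := weak_le_dvd zw; exists (p * q).
    by rewrite xE yE zp !mulgA.
  move=> v iv [p]; rewrite (artin_lift_descent iv) xE -mulgA => e.
  have {}e : y = lift (s i * v) * p.
    by apply: cancel_below e; rewrite -xE.
  rewrite -(coxeter_genK i v); apply: weak_le_ascent => //.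
  apply: topz; first by rewrite ldescent_gen iv.
  by apply: top; exists p.
have [x1|[i [y xE]]] := artin_first x.
  exists 1; first by rewrite artin_lift1; exists x; rewrite mul1g.
  move=> v [p]; rewrite x1 => /(congr1 alen).
  rewrite artin_length1 artin_lengthM artin_length_lift => /esym/eqP.
  by rewrite addn_eq0 => /andP[/eqP/len_eq0 -> _]; apply: weak_le_refl.
have [|w [iw wx top]] := maxi i; first by exists y.
exists w => // v vx; have [->|/descent_first[j jv]] := pselect (v = 1).
  exact: weak_le1.
have jx : left_dvd (gen j) x.
  by apply: left_dvd_trans vx; exists (lift (s j * v)); apply: artin_lift_descent.
have [w' [jw' w'x top']] := maxi j jx.
apply: weak_le_trans (top' v jv vx) _; apply: top => //.
have [z xE'] := jx; have lt : alen y < L.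
  by rewrite -add1n -(artin_length_gen i) -artin_lengthM -xE.
case: (HL lt (etrans (esym xE) xE')) => [[-> //]|[ij [k [q [mij yE _]]]]].
have [red _ desc] := braid_word cox ij mij.
apply: (weak_le_ldescent (top' (cw (alt k.+1 i j)) _ _)); last 2 first.
- rewrite artin_lift_word //; exists q.
  by rewrite xE yE -[alt k.+1 i j]/(i :: alt k j i) artin_word_cons mulgA.
- by apply: desc; left.
by apply: desc; right.
Qed.

(** Write [v] as [alt n i k] followed by [d]. Then [s k * v] is [alt n.+1 k i] followed by [d], and
    the braid relation exposes the first letter [i]. Cancelling [alt n i k] gives
    [z = aw d * x']. *)
Lemma completes_lift i k n z (v : W) x' : i <> k -> m i k = Some n.+1 ->
  alen (aw (alt n i k) * z) <= L -> aw (alt n i k) * z = lift v * x' ->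
  ~~ ldescent k v -> weak_le (cw (alt n i k)) v ->
  ldescent i (s k * v) /\ aw (alt n k i) * z = lift (s i * (s k * v)) * x'.
Proof.
move=> ik mik lL e kv le; have [red eqw _] := braid_word cox ik mik.
have mki : m k i = Some n.+1 by have [<- _ _] := cox.
have [red' _ _] := braid_word cox (fun e => ik (esym e)) mki.
have [rik _] := reduced_cons (red' : is_reduced m (k :: alt n i k)).
have [d rd dv] := weak_le_word rik le.
have rkd : is_reduced m (k :: (alt n i k ++ d)) by apply: cons_reduced; rewrite ?dv.
have gE : s k * v = cw (i :: (alt n k i ++ d)).
  rewrite -dv -coxeter_word_cons -[k :: _]/(alt n.+1 k i ++ d) coxeter_word_cat.
  by rewrite -eqw -coxeter_word_cat.
have rid : is_reduced m (i :: (alt n k i ++ d)).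
  rewrite /is_reduced -gE -dv -coxeter_word_cons rkd /= !size_cat !size_alt.
  by [].
have [rnd ind] := reduced_cons rid.
rewrite gE coxeter_word_cons ldescent_gen coxeter_genK; split=> //.
rewrite artin_lift_word // artin_word_cat -mulgA; congr (_ * _).
move: e; rewrite -dv artin_lift_word // artin_word_cat -mulgA.
exact: cancel_below.
Qed.

(* [y] has a greatest simple divisor; let [v] be the largest simple element below
   it without descent [k]. Then [s k * v] is simple and has both [i] and [j] as
   descents. *)
Lemma completes_trans k y i x j z : alen y <= L ->
  completes i x k y -> completes k y j z -> completes i x j z.
Proof.
move=> yL [[-> -> //]|[ik [n [p [mik xE yE]]]]].
case=> [[<- <-]|[kj [n' [p' [mkj yE' zE]]]]].
  by right; split=> //; exists n, p.
have mjk : m j k = Some n'.+1 by have [<- _ _] := cox.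
have jk : j <> k by move/esym.
have [w wy top] := max_simple_below yL.
have simple l q r : l <> k -> m l k = Some q.+1 -> y = aw (alt q l k) * r ->
    ~~ ldescent k (cw (alt q l k)) /\ weak_le (cw (alt q l k)) w.
  move=> lk mlk e; have mkl : m k l = Some q.+1 by have [<- _ _] := cox.
  have [red _ _] := braid_word cox (fun e => lk (esym e)) mkl.
  have [rlk nk] := reduced_cons (red : is_reduced m (k :: alt q l k)).
  by split=> //; apply: top; exists r; rewrite artin_lift_word.
have [v [vw kv topv]] := weak_avoid cox k w.
have [q yq] := left_dvd_trans (weak_le_dvd vw) wy.
have [k1 l1] := simple _ _ _ ik mik yE; have [k2 l2] := simple _ _ _ jk mjk yE'.
have yL1 := yL; rewrite yE in yL1; have yL2 := yL; rewrite yE' in yL2.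
have [ig xg] := completes_lift ik mik yL1 (etrans (esym yE) yq) kv (topv _ k1 l1).
have [jg zg] := completes_lift jk mjk yL2 (etrans (esym yE') yq) kv (topv _ k2 l2).
rewrite {}xE {}zE xg zg; have [ij|ij] := pselect (i = j).
  by left; rewrite ij.
right; split=> //; move: (s k * v) ig jg => g ig jg.
have [[|N] mij le] := braid_weak_le cox ij ig jg.
  by have [_ /(_ i j)] := cox; rewrite mij.
have [red eqw _] := braid_word cox ij mij.
have [d rd dg] := weak_le_word red le.
have dg' : cw (alt N.+1 j i ++ d) = g.
  by rewrite coxeter_word_cat -eqw -coxeter_word_cat.
have rd' : is_reduced m (alt N.+1 j i ++ d).
  by rewrite /is_reduced dg' -dg rd !size_cat !size_alt.
have [r1 _] := reduced_cons (rd : is_reduced m (i :: (alt N j i ++ d))).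
have [r2 _] := reduced_cons (rd' : is_reduced m (j :: (alt N i j ++ d))).
exists N, (aw d * q); split=> //.
  rewrite -dg -[_ ++ d]/(i :: (alt N j i ++ d)) coxeter_word_cons coxeter_genK.
  by rewrite artin_lift_word // artin_word_cat mulgA.
rewrite -dg' -[_ ++ d]/(j :: (alt N i j ++ d)) coxeter_word_cons coxeter_genK.
by rewrite artin_lift_word // artin_word_cat mulgA.
Qed.

Definition completes_words u v := match u, v with
  | [::], [::] => True
  | i :: u, j :: v => completes i (aw u) j (aw v)
  | _, _ => False
  end.

(** Induction on the derivation: a relation applied at the head is a completion, one applied further
    on keeps the first letter, and chains are composed by [completes_trans]. *)
Lemma cong_completes u v : cong (braid_rel m) u v -> size u <= L.+1 ->
  completes_words u v.
Proof.
elim=> {u v} [a b u v|u|u v uv IH|u v w uv IH1 vw IH2].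
- case: a => [|i a] uv _ /=; last first.
    by left; split=> //; apply/pres_classP; apply: cong_rel.
  case: uv => i j [|n] mij; first by have [_ /(_ i j)] := cox.
  rewrite /= !artin_word_cat; have [ij|ij] := pselect (i = j).
    by left; rewrite ij.
  by right; split=> //; exists n, (aw b).
- by case: u => //= i u _; left.
- rewrite -(cong_size uv) => /IH; case: u {uv IH} => [|i u]; case: v => [|j v] //=.
  exact: completes_sym.
move=> su; have := IH1 su; have := IH2; rewrite -(cong_size uv) => /(_ su).
have := cong_size uv; case: u su {IH1 IH2 uv vw} => [|i u]; case: v => [|j v] //;
  case: w => [|k w] //= su [suv] jk ij.
by apply: completes_trans ij jk; rewrite artin_length_word -suv.
Qed.

End BelowLength.

Lemma artin_completion L : completion L.
Proof.
elim: L => // L IH i j x y; have [u <-] := artin_word_exists x.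
have [v <-] := artin_word_exists y.
rewrite artin_length_word -!artin_word_cons => su /pres_classP/(cong_completes IH).
exact.
Qed.

Lemma artin_cancel p : injective (mul p : B -> B).
Proof.
move=> x y; exact: (cancel_below (artin_completion (L := alen (p * x))) (leqnn _)).
Qed.

Lemma artin_max_simple x : exists2 w, left_dvd (lift w) x &
  forall t, left_dvd (lift t) x -> weak_le t w.
Proof. exact: (max_simple_below (artin_completion (L := alen x)) (leqnn _)). Qed.

End ArtinMonoid.

(** * Morphisms respecting lcms *)

Section LcmTransfer.
Variables (I' I : Type) (m' : I' -> I' -> option nat) (m : I -> I -> option nat).
Hypotheses (cox' : coxeter_matrix m') (cox : coxeter_matrix m).
Variable f : artin_monoid m' -> artin_monoid m.
Hypothesis f_morphism : monoid_morphism f.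
Local Notation gen := (artin_gen m').
Local Notation aw := (artin_word m').
Hypothesis f_gen_neq1 : forall a, f (gen a) <> 1.
Hypothesis f_join : forall a b t, a <> b ->
  left_dvd (f (gen a)) t -> left_dvd (f (gen b)) t ->
  exists2 n, m' a b = Some n & left_dvd (f (aw (alt n a b))) t.

Let fM x y : f (x * y) = f x * f y.
Proof. exact: f_morphism.2. Qed.

Lemma left_dvd_morphism x y : left_dvd x y -> left_dvd (f x) (f y).
Proof. by move=> [z ->]; exists (f z). Qed.

Lemma gen_dvd_alt a b n : m' a b = Some n ->
  left_dvd (gen a) (aw (alt n a b)) /\ left_dvd (gen b) (aw (alt n a b)).
Proof.
case: n => [|n] mab; first by have [_ /(_ a b)] := cox'; rewrite mab.
split; first by exists (aw (alt n b a)); rewrite /= artin_word_cons.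
rewrite (artin_word_alt mab).
by exists (aw (alt n a b)); rewrite /= artin_word_cons.
Qed.

(** Equal first generators cancel. If [u] starts with [a] and [x] with [b], [f_join] makes the image
    of their lcm divide [f x]; after cancelling [b], induction shows that the lcm divides [x], so
    [x] can also be written with first generator [a]. *)
Lemma left_dvd_reflect u x : left_dvd (f u) (f x) -> left_dvd u x.
Proof.
have [n] := ubnP (artin_length x); elim: n u x => // n IH u x lx.
have [->|[a [u' ->]]] := artin_first u; first by exists x; rewrite mul1g.
have cancel_gen y : artin_length y < n ->
    left_dvd (f (gen a * u')) (f (gen a * y)) -> left_dvd (gen a * u') (gen a * y).
  move=> ly [q]; rewrite !fM -mulgA => /(artin_cancel cox) e.
  have [|p ->] := IH u' y ly; first by exists q.
  by exists p; rewrite mulgA.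
have [x1|[b [x' xE]]] := artin_first x.
  rewrite x1 f_morphism.1 => -[q /(congr1 (@artin_length _ _))/esym/eqP].
  rewrite artin_length1 fM !artin_lengthM !addn_eq0 => /andP[/andP[/eqP]].
  by move=> /artin_length_eq0/f_gen_neq1.
have lx' : artin_length x' < n.
  by move: lx; rewrite xE artin_lengthM artin_length_gen.
have [ab|ab] := pselect (a = b); first by rewrite xE -ab; apply: cancel_gen.
move=> ux; have ax : left_dvd (f (gen a)) (f x).
  by apply: left_dvd_trans ux; apply: left_dvd_morphism; exists u'.
have bx : left_dvd (f (gen b)) (f x) by apply: left_dvd_morphism; exists x'.
have [k mab [q xq]] := f_join ab ax bx.
have [[p ap] [p' bp]] := gen_dvd_alt mab.
have [|p'' x'E] := IH p' x' lx'.
  exists q; apply: (artin_cancel cox (p := f (gen b))).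
  by rewrite mulgA -!fM -bp -xq xE.
have xE' : x = gen a * (p * p'') by rewrite mulgA -ap bp -mulgA -x'E.
rewrite xE'; apply: cancel_gen; last by rewrite -xE'.
by move: lx; rewrite xE' artin_lengthM artin_length_gen.
Qed.

Lemma lcm_morphism_inj : injective f.
Proof.
by move=> x y xy; apply: left_dvd_anti; apply: left_dvd_reflect;
   rewrite xy; exists 1; rewrite mulg1.
Qed.

Lemma is_right_lcm_uniq (J : Type) (k : J -> J -> option nat)
    (x y z z' : artin_monoid k) :
  is_right_lcm x y z -> is_right_lcm x y z' -> z = z'.
Proof. by move=> [xz yz top] [xz' yz' top']; apply: left_dvd_anti; auto. Qed.

Lemma is_right_lcmxx (M : monoidType) (x : M) : is_right_lcm x x x.
Proof. by split=> //; exists 1; rewrite mulg1. Qed.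

Lemma respects_right_lcms_of_join : respects_right_lcms f.
Proof.
split=> // a b; have [->|ab] := pselect (a = b).
  split=> [|z z' h h'].
    by split=> _; [exists (f (gen b))|exists (gen b)]; apply: is_right_lcmxx.
  rewrite (is_right_lcm_uniq h (is_right_lcmxx _)).
  by rewrite (is_right_lcm_uniq h' (is_right_lcmxx _)).
have lcm n : m' a b = Some n -> is_right_lcm (gen a) (gen b) (aw (alt n a b)) /\
    is_right_lcm (f (gen a)) (f (gen b)) (f (aw (alt n a b))).
  move=> mab; have [ac bc] := gen_dvd_alt mab.
  have top t : left_dvd (f (gen a)) t -> left_dvd (f (gen b)) t ->
      left_dvd (f (aw (alt n a b))) t.
    by move=> /(f_join ab) h /h[k]; rewrite mab => -[<-].
  split; split=> //; try exact: left_dvd_morphism.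
  by move=> t at_ bt; apply/left_dvd_reflect/top; apply: left_dvd_morphism.
split=> [|z z' h h'].
  split=> -[z [az bz _]].
    have [n mab _] := f_join ab (left_dvd_morphism az) (left_dvd_morphism bz).
    by have [_ h] := lcm n mab; exists (f (aw (alt n a b))).
  have [n mab _] := f_join ab az bz.
  by have [h _] := lcm n mab; exists (aw (alt n a b)).
have [az bz _] := h.
have [n mab _] := f_join ab (left_dvd_morphism az) (left_dvd_morphism bz).
have [l l'] := lcm n mab.
by rewrite (is_right_lcm_uniq h l) (is_right_lcm_uniq h' l').
Qed.

End LcmTransfer.

(** * The anti-automorphism reversing words *)

Section Reversal.
Variables (I : Type) (m : I -> I -> option nat).
Hypothesis cox : coxeter_matrix m.
Local Notation aw := (artin_word m).
Implicit Types x y z : artin_monoid m.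

Definition artin_rev x : artin_monoid m := aw (rev (pres_repr x)).

Lemma artin_rev_word u : artin_rev (aw u) = aw (rev u).
Proof.
suff cong_rev v w : cong (braid_rel m) v w -> cong (braid_rel m) (rev v) (rev w).
  exact/pres_classP/cong_rev/pres_classP/pres_reprK.
elim=> {u v w} [a b u v [i j n mij]|u|u v _|u v w _ IH1 _ IH2].
- rewrite !rev_cat -!catA !rev_alt.
  have mji : m j i = Some n by have [<- _ _] := cox.
  by case: odd; apply/cong_rel/braid_rel_intro.
- exact: cong_refl.
- exact: cong_sym.
- exact: cong_trans IH1 IH2.
Qed.

Lemma artin_revM x y : artin_rev (x * y) = artin_rev y * artin_rev x.
Proof.
have [u <-] := artin_word_exists x; have [v <-] := artin_word_exists y.
by rewrite -artin_word_cat !artin_rev_word rev_cat artin_word_cat.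
Qed.

Lemma artin_revK : involutive artin_rev.
Proof.
by move=> x; have [u <-] := artin_word_exists x; rewrite !artin_rev_word revK.
Qed.

Lemma artin_rev_gen i : artin_rev (artin_gen m i) = artin_gen m i.
Proof. exact: (artin_rev_word [:: i]). Qed.

Lemma artin_rev_lift w : artin_rev (artin_lift w) = artin_lift w^-1.
Proof.
have [u <- ru] := reduced_exists w; rewrite -coxeter_word_rev !artin_lift_word //.
  exact: artin_rev_word.
by rewrite /is_reduced coxeter_word_rev lenV size_rev ru.
Qed.

Lemma right_dvd_rev x y : right_dvd x y <-> left_dvd (artin_rev x) (artin_rev y).
Proof.
split=> [[z ->]|[z e]]; first by exists (artin_rev z); apply: artin_revM.
by exists (artin_rev z); rewrite -[y]artin_revK e artin_revM artin_revK.
Qed.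

Lemma is_left_lcm_rev x y z :
  is_left_lcm x y z <-> is_right_lcm (artin_rev x) (artin_rev y) (artin_rev z).
Proof.
split=> -[xz yz top]; split; try exact/right_dvd_rev.
  move=> t; rewrite -(artin_revK t) => /right_dvd_rev xt /right_dvd_rev yt.
  by apply/right_dvd_rev/top.
by move=> t /right_dvd_rev xt /right_dvd_rev yt; apply/right_dvd_rev/top.
Qed.

End Reversal.

(** * Left lcm's, obtained by reversal *)

Section LeftLcms.
Variables (I' I : Type) (m' : I' -> I' -> option nat) (m : I -> I -> option nat).
Hypotheses (cox' : coxeter_matrix m') (cox : coxeter_matrix m).
Variable f : artin_monoid m' -> artin_monoid m.
Hypothesis f_morphism : monoid_morphism f.
Local Notation gen := (artin_gen m').
Hypothesis f_rev_gen : forall a, artin_rev (f (gen a)) = f (gen a).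

Lemma morphism_rev x : f (artin_rev x) = artin_rev (f x).
Proof.
have [u <-] := artin_word_exists x; elim: u => [|a u IH].
  by rewrite (artin_rev_word cox') artin_word_nil f_morphism.1
    (artin_rev_word cox [::]).
rewrite artin_word_cons (artin_revM cox') f_morphism.2 IH (artin_rev_gen cox').
by rewrite f_morphism.2 (artin_revM cox) f_rev_gen.
Qed.

Lemma respects_left_lcms_of_right : respects_right_lcms f -> respects_left_lcms f.
Proof.
move=> [f1 lcm]; split=> // a b; have [ex val] := lcm a b.
have L z : is_left_lcm (gen a) (gen b) z <-> is_right_lcm (gen a) (gen b) (artin_rev z).
  by rewrite (is_left_lcm_rev cox') !(artin_rev_gen cox').
have L' z : is_left_lcm (f (gen a)) (f (gen b)) z <->
    is_right_lcm (f (gen a)) (f (gen b)) (artin_rev z).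
  by rewrite (is_left_lcm_rev cox) !f_rev_gen.
split=> [|z z' /L h /L' h'].
  split=> -[z].
    by move=> /L h; have [z' h'] := ex.1 (ex_intro _ _ h);
       exists (artin_rev z'); apply/L'; rewrite (artin_revK cox).
  by move=> /L' h; have [z' h'] := ex.2 (ex_intro _ _ h);
     exists (artin_rev z'); apply/L; rewrite (artin_revK cox').
by rewrite -(artin_revK cox z') (val _ _ h h') -morphism_rev (artin_revK cox').
Qed.

End LeftLcms.

(** * Admissible partitions *)

Section Longest.
Variables (I : Type) (m : I -> I -> option nat).
Hypothesis cox : coxeter_matrix m.
Local Notation W := (coxeter_group m).
Local Notation s := (coxeter_gen m).
Local Notation len := (@coxeter_length I m).
Local Notation par := (@parabolic I m).
Implicit Types (i j : I) (w x y : W) (J : set I).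

Lemma coxeter_gen_inj : injective s.
Proof.
move=> i j e; apply: contrapT => ij; have [_ _ m1] := cox.
have := Geometric.order_gen cox (q := 1) ij.
rewrite expg1 e coxeter_gen_sqr => /(_ erefl).
by case mij: (m i j) => [n|//]; rewrite dvdn1 => /eqP n1;
   case: ij; apply/m1; rewrite mij n1.
Qed.

(** Exchange puts [s i] into the parabolic subgroup, where it has a reduced word of one letter of
    [J]; distinct letters give distinct generators. *)
Lemma parabolic_descent J i w : par J w -> ldescent i w -> J i.
Proof.
move=> Jw iw; have [u [Ju uw _]] := parabolic_reduced Jw.
have Ji : par J (s i).
  have [a [k [b [uE e]]]] : exists a k b,
      u = a ++ k :: b /\ s i * coxeter_word m u = coxeter_word m (a ++ b).
    by apply: exchange; rewrite uw.
  rewrite -(mulgK (coxeter_word m u) (s i)) e; apply: parabolicM.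
    apply/parabolicP; exists (a ++ b) => //.
    by move: Ju; rewrite uE; apply: letters_in_delete.
  by rewrite uw; apply: parabolicV.
have [v [Jv vE]] := parabolic_reduced Ji.
rewrite /is_reduced vE len_coxeter_gen.
case: v Jv vE => [|k [|//]] //= /andP[/asboolP Jk _].
by rewrite coxeter_word1 => /coxeter_gen_inj <-.
Qed.

(** An element of maximal length has all of [J] as descents, hence lies above the whole subgroup in
    weak order; this makes it unique. *)
Lemma longest_exists J : spherical m J ->
  exists w, par J w /\ forall x, par J x -> x <> w -> len x < len w.
Proof.
move=> /finite_seqP[r rE].
have [x Jx maxx] : exists2 x, par J x & forall y, par J y -> len y <= len x.
  have [] := @ex_maxnP (fun n => n \in map len r) (\max_(n <- map len r) n).
  - exists 0; apply/mapP; exists 1; last by rewrite len1.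
    by have : par J 1 := @parabolic1 I m J; rewrite rE.
  - by move=> n nr; apply: leq_bigmax_seq.
  move=> n /mapP[x xr ->] top; exists x; first by rewrite rE.
  by move=> y; rewrite rE => yr; apply: top; apply: map_f.
exists x; split=> // y Jy yx; have le : weak_le y x.
  apply: parabolic_weak_le Jy => j Jj; apply: contraT => jx.
  by have := maxx (s j * x); rewrite len_ascent // ltnn; apply;
     apply: parabolicM => //; apply: parabolic_gen.
by rewrite ltnNge; apply/negP => /(weak_le_eq le).
Qed.

Lemma longest_block J : spherical m J -> (J !=set0)%classic -> is_block J (longest m J).
Proof.
move=> /longest_exists /(xgetPex 1); rewrite -/(longest m J) => -[Jr top] [i Ji].
have dr : descents_on J (longest m J).
  move=> j Jj; rewrite /ldescent; apply: top.
    by apply: parabolicM => //; apply: parabolic_gen.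
  by rewrite -[X in _ <> X]mul1g => /mulIg/(block_neq1 (singleton_block m j)).
split=> //; last first.
  by move=> r1; have := dr i Ji; rewrite r1 ldescent1.
(* The inverse has the same length, so it cannot be another element of the subgroup. *)
have : (longest m J)^-1 = longest m J.
  apply: contrapT => /(top _ (parabolicV Jr)).
  by rewrite lenV ltnn.
by move=> {1}<-; rewrite mulVg.
Qed.

End Longest.

(** * The morphism attached to an admissible partition *)

Section AdmissiblePartition.
Variables (I : Type) (m : I -> I -> option nat) (P : set (set I)).
Hypotheses (cox : coxeter_matrix m) (adm : admissible_partition m P).
Local Notation W := (coxeter_group m).
Local Notation len := (@coxeter_length I m).
Local Notation tilde := (@tilde_group I m).
Local Notation mt := (@partition_type I m P).
Local Notation lift := (@artin_lift I m).
Implicit Types (a b c : P) (i : I) (w : W).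

Let r a : W := longest m (val a).

Let Pa a : P (val a). Proof. exact: set_valP. Qed.

Lemma partition_block a : is_block (val a) (r a).
Proof.
have [[[_ _ ne] sph] _] := adm.
by apply: longest_block; [exact: sph|exact: ne].
Qed.

Lemma alt_prod_tilde n a b : tilde P (alt_prod n (r a) (r b)).
Proof.
move=> H [[/set_mem H1 HF] HP].
have HV x : H x -> H x^-1.
  by move=> Hx; rewrite -div1g; apply/set_mem/HF; apply/mem_set.
elim: n a b => [|n IH] a b; first by rewrite alt_prod0.
rewrite alt_prodS -[alt_prod n _ _]invgK; apply/set_mem/HF; apply/mem_set.
  by apply: HP; exists (val a).
exact/HV/IH.
Qed.

Lemma tilde_groupV w : tilde P w -> tilde P w^-1.
Proof.
move=> Pw H HH; have [[/set_mem H1 HF] _] := HH.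
by rewrite -div1g; apply/set_mem/HF; apply/mem_set => //; apply: Pw.
Qed.

(** Admissibility concerns multiplication on the right, [ldescent] on the left; taking inverses
    translates between them. *)
Lemma ascents_ldescent i w : ascents w^-1 i <-> ~~ ldescent i w.
Proof.
have e : len (w^-1 * coxeter_gen m i) = len (coxeter_gen m i * w).
  by rewrite -lenV invgM invgK coxeter_genV.
rewrite /ascents /= e lenV; split=> [h|h]; last exact: len_ascent.
by rewrite /ldescent h ltnNge leqnSn.
Qed.

Lemma descents_ldescent i w : descents w^-1 i <-> ldescent i w.
Proof.
have e : len (w^-1 * coxeter_gen m i) = len (coxeter_gen m i * w).
  by rewrite -lenV invgM invgK coxeter_genV.
rewrite /descents /= e lenV; split=> [h|h]; last by rewrite -len_descent.
by rewrite /ldescent -h.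
Qed.

Lemma tilde_compat n a b c : descents_on (val c) (alt_prod n (r a) (r b)) \/
  ascents_on (val c) (alt_prod n (r a) (r b)).
Proof.
have [_ /(_ _ (val c) (tilde_groupV (alt_prod_tilde n a b)) (Pa c))] := adm.
by case=> h; [right|left] => j /h; rewrite ?ascents_ldescent ?descents_ldescent.
Qed.

(** A point of [a] is a descent of the common element, hence lies in [b], and distinct parts are
    disjoint. *)
Lemma longest_inj a b : r a = r b -> a = b.
Proof.
move=> e; have [[[_ triv ne] _] _] := adm.
have [i ai] := ne _ (Pa a); apply: val_inj; apply: triv => //; exists i; split=> //=.
apply: (parabolic_descent cox (block_par (partition_block b))).
by rewrite -e; apply: block_desc (partition_block a) _ ai.
Qed.

Lemma partition_type_cox : coxeter_matrix mt.
Proof.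
have sqr a := block_sqr (partition_block a).
have rV a : (r a)^-1 = r a by apply/mulg1_eq/sqr.
split=> [a b|a b|a b]; rewrite /partition_type.
- by rewrite -elt_orderV invgM !rV.
- by move=> /elt_order_some[].
rewrite elt_order1P -!/(r _); split=> [/mulg1_eq|->]; last exact: sqr.
by rewrite rV => /longest_inj.
Qed.

Lemma partition_braid a b n : a <> b -> mt a b = Some n ->
  [/\ alt_prod n (r a) (r b) = alt_prod n (r b) (r a),
      len (alt_prod n (r a) (r b)) = alt_sum n (len (r a)) (len (r b)),
      len (alt_prod n (r b) (r a)) = alt_sum n (len (r b)) (len (r a)) &
      descents_on (val a `|` val b)%classic (alt_prod n (r a) (r b))].
Proof.
move=> ab /elt_order_some[n0 rn least].
exact: (two_blocks_order (partition_block a) (partition_block b)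
  (fun n => tilde_compat n b a a) (fun n => tilde_compat n a b b)).
Qed.

Lemma lift_alt_prod n (x y : W) : len (alt_prod n x y) = alt_sum n (len x) (len y) ->
  lift (alt_prod n x y) = alt_prod n (lift x) (lift y).
Proof.
elim: n x y => [|n IH] x y; first by rewrite !alt_prod0 artin_lift1.
move=> e; have [e' _] := len_alt_prodS e; rewrite !alt_prodS -(IH _ _ e').
by apply: artin_liftM => //; rewrite -alt_prodS e e'.
Qed.

Let f a := lift (r a).

(** Lengths add up to the order of the product, so the equality of alternating products in the group
    lifts factor by factor. *)
Lemma tilde_braid u v : braid_rel mt u v ->
  \prod_(a <- u) f a = \prod_(a <- v) f a.
Proof.
case=> a b n mab; have [->//|ab] := pselect (a = b).
have [e la lb _] := partition_braid ab mab.
by rewrite !alt_prod_map /f -!lift_alt_prod // e.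
Qed.

Definition tilde_morphism : artin_monoid mt -> artin_monoid m := pres_map f.

Lemma tilde_morphism_gen a : tilde_morphism (artin_gen mt a) = f a.
Proof. by rewrite /tilde_morphism pres_map_class ?big_seq1 //; apply: tilde_braid. Qed.

Lemma tilde_morphism_monoid : monoid_morphism tilde_morphism.
Proof. exact: pres_map_morphism tilde_braid. Qed.

Lemma tilde_gen_neq1 a : tilde_morphism (artin_gen mt a) <> 1.
Proof.
rewrite tilde_morphism_gen => /(congr1 (@artin_length _ _)).
rewrite artin_length_lift // artin_length1 => /len_eq0.
exact: block_neq1 (partition_block a).
Qed.

(** The greatest simple divisor [w] of [t] has both blocks as descents. This makes the order finite
    and puts [w] above the parabolic subgroup of both blocks, in particular above the alternating
    product. *)
Lemma tilde_join a b t : a <> b ->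
  left_dvd (tilde_morphism (artin_gen mt a)) t ->
  left_dvd (tilde_morphism (artin_gen mt b)) t ->
  exists2 n, mt a b = Some n &
    left_dvd (tilde_morphism (artin_word mt (alt n a b))) t.
Proof.
move=> ab; rewrite !tilde_morphism_gen => at_ bt.
have [w wt top] := artin_max_simple cox t.
have dw : descents_on (val a `|` val b)%classic w.
  move=> j [aj|bj].
    apply: (weak_le_ldescent (top _ at_)); exact: block_desc (partition_block a) _ aj.
  apply: (weak_le_ldescent (top _ bt)); exact: block_desc (partition_block b) _ bj.
have [n n0 rn] := two_blocks_finite (partition_block a) (partition_block b)
  (fun n => tilde_compat n b a a) (fun n => tilde_compat n a b b) dw.
case mab: (mt a b) => [k|]; last by case: (elt_order_none mab n0).
exists k => //; have [e la _ _] := partition_braid ab mab.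
rewrite /tilde_morphism pres_map_class; last exact: tilde_braid.
rewrite alt_prod_map /f -lift_alt_prod //; apply: left_dvd_trans wt.
apply: weak_le_dvd => //; apply: parabolic_weak_le dw _ _.
have pa : parabolic (val a `|` val b)%classic (r a).
  by apply: parabolicS (block_par (partition_block a)) => i; left.
have pb : parabolic (val a `|` val b)%classic (r b).
  by apply: parabolicS (block_par (partition_block b)) => i; right.
elim: {mab e la} k (r a) (r b) pa pb => [|k IH] x y px py.
  by rewrite alt_prod0; apply: parabolic1.
by rewrite alt_prodS; apply: parabolicM => //; apply: IH.
Qed.

Lemma tilde_morphism_inj : injective tilde_morphism.
Proof.
exact: (lcm_morphism_inj partition_type_cox cox tilde_morphism_monoid
  tilde_gen_neq1 tilde_join).
Qed.

Lemma tilde_respects_lcms : respects_lcms tilde_morphism.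
Proof.
have right := respects_right_lcms_of_join partition_type_cox cox
  tilde_morphism_monoid tilde_gen_neq1 tilde_join.
split=> //; apply: (respects_left_lcms_of_right partition_type_cox cox
  tilde_morphism_monoid) => // a.
rewrite tilde_morphism_gen /f artin_rev_lift //.
(* Reversal lifts inversion, and [r a] is an involution. *)
by rewrite (mulg1_eq (block_sqr (partition_block a))).
Qed.

Local Notation S := (range f).

Lemma tilde_morphism_range x : gen_submonoid S x <-> range tilde_morphism x.
Proof.
have [phi1 phiM] := tilde_morphism_monoid.
split=> [|[y _ <-]].
  apply: (smallest_sub (X := range tilde_morphism)).
    split=> [|_ _ /set_mem[y _ <-] /set_mem[z _ <-]]; apply/mem_set.
      by exists 1.
    by exists (y * z).
  by move=> _ [a _ <-]; exists (artin_gen mt a); rewrite // tilde_morphism_gen.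
move=> H [[/set_mem H1 HM] HS]; have [u <-] := artin_word_exists y.
elim: u => [|a u IH]; first by rewrite artin_word_nil phi1.
rewrite artin_word_cons phiM tilde_morphism_gen.
by apply/set_mem/HM; apply/mem_set => //; apply: HS; exists a.
Qed.

Lemma tilde_submonoid_iso :
  pair_iso (M := submonoid S) (N := artin_monoid mt)
    [set x | S (val x)]%classic (range (artin_gen mt)).
Proof.
have [phi1 phiM] := tilde_morphism_monoid.
have ex (x : submonoid S) : exists y, tilde_morphism y = val x.
  by have /set_mem/tilde_morphism_range[y _ <-] := valP x; exists y.
(* The isomorphism starts from the submonoid, so it chooses preimages under [tilde_morphism];
   injectivity makes it a morphism. *)
pose g (x : submonoid S) := projT1 (cid (ex x)).
have gE x : tilde_morphism (g x) = val x by rewrite /g; case: cid.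
have mem y : tilde_morphism y \in gen_submonoid S.
  by apply/mem_set/tilde_morphism_range; exists y.
pose h y : submonoid S := Sub (tilde_morphism y) (mem y).
have hK : cancel h g.
  by move=> y; apply: tilde_morphism_inj; rewrite gE SubK.
have gK : cancel g h by move=> x; apply: val_inj; rewrite SubK gE.
exists g; split; last 2 first.
- by exists h.
- apply/seteqP; split=> [_ [x [a _ fa] <-]|_ [a _ <-]].
    exists a => //; apply: tilde_morphism_inj.
    by rewrite gE tilde_morphism_gen fa.
  exists (h (artin_gen mt a)); last by rewrite hK.
  by exists a => //=; rewrite tilde_morphism_gen.
split=> [|x y]; apply: tilde_morphism_inj; first by rewrite gE phi1.
by rewrite phiM !gE.
Qed.

End AdmissiblePartition.

Theorem theorem23 (I : Type) (m : I -> I -> option nat) (P : set (set I))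
    (Gamma_coxeter : coxeter_matrix m) (P_admissible : admissible_partition m P) :
  let mt := @partition_type I m P in
  let r (a : P) := artin_lift (longest m (val a)) in
  [/\ coxeter_matrix mt,
      exists phi : artin_monoid mt -> artin_monoid m,
        [/\ monoid_morphism phi,
            forall a : P, phi (artin_gen mt a) = r a,
            respects_lcms phi &
            injective phi] &
      pair_iso (M := submonoid (range r)) (N := artin_monoid mt)
        [set x | range r (val x)]%classic (range (artin_gen mt))].
Proof.
move=> mt r; split; first exact: partition_type_cox.
  exists (@tilde_morphism I m P); split.
  - exact: tilde_morphism_monoid.
  - exact: tilde_morphism_gen.
  - exact: tilde_respects_lcms.
  - exact: tilde_morphism_inj.
exact: tilde_submonoid_iso.
Qed.
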